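(* Let $w_n$, $\overline F$ be the wandering rate and return-time tail of a Markov chain satisfying Assumption (A1) of the context with $0<\beta<1/2$. Let $\nu$ be a Lévy measure on $\mathbb R$, $\bar\nu(x)=\nu((x,\infty))$, $V=(1/\bar\nu)^{\leftarrow}$, and $a_n=h\circ V(w_n)$ with $h$ the auxiliary function of Assumption (A2) of the context. Consider the relation $$\lim_{n\to\infty}\frac{V\bigl(1/\overline F(n)\bigr)}{a_n}=0.\qquad( * )$$ (a) If $\bar\nu(x)\sim c\,x^{p}(\log x)^{\xi}\exp(-\lambda(\log x)^{\gamma})$ as $x\to\infty$ for some $\gamma>1$, $\lambda,c>0$ and $p,\xi\in\mathbb R$, then $( * )$ holds. (b) If $\bar\nu(x)\sim c\,x^{p}(\log x)^{\xi}\exp(\lambda(\log x)^{\gamma})\exp\bigl(-\rho\exp(\mu(\log x)^{\alpha})\bigr)$ as $x\to\infty$ for some $\alpha\in(0,1)$, $c,\mu,\rho>0$ and $p,\xi,\lambda,\gamma\in\mathbb R$, then $( * )$ holds if $0<\alpha<1/2$ and fails if $1/2<\alpha<1$.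
   Context: **Asymptotic notation.** For positive functions, as the argument tends to $\infty$: $f\sim g$ means $f/g\to1$; $f\gg g$ (or $g\ll f$) means $f/g\to\infty$; $f\lesssim g$ means $f\le Cg$ eventually for some $C>0$; $f\gtrsim g$ means $g\lesssim f$; $f\asymp g$ means both. For nondecreasing $J$, $J^{\leftarrow}(y)=\inf\{s:J(s)\ge y\}$. **Markov chain.** Let $\{Y_t\}_{t\in\mathbb Z}$ be an irreducible, aperiodic, null recurrent Markov chain on $\mathbb Z$ with unique invariant measure $(\pi_i)_{i\in\mathbb Z}$ normalized by $\pi_0=1$. Let $E=\mathbb Z^{\mathbb Z}$, let $P_i$ be the law on $E$ of the (two-sided) chain given $Y_0=i$, and let $\mu=\sum_i\pi_iP_i$. (In the claim, the symbol $\mu$ in (b) is instead a positive real parameter.) Put $w_n=\mu(\{y\in E: y_k=0\text{ for some }0\le k\le n\})$ and $\varphi(y)=\inf\{t\ge1:y_t=0\}$. **Assumption (A1)** (with $\beta\in(0,1)$): there is a slowly varying function $L$ with $\overline F(n):=P_0(\varphi>n)=n^{-\beta}L(n)$, and $\sup_{n\ge0}nP_0(\varphi=n)/\overline F(n)<\infty$. **Assumption (A2)** on $\nu$ (satisfied by the tails in (a) and (b)): $\nu(\cdot\cap(1,\infty))/\nu((1,\infty))$ is subexponential (its tail $\overline H$ satisfies $\overline{H*H}(x)/\overline H(x)\to2$) and in the maximum domain of attraction of the Gumbel law. Moreover there are a distribution $H_\#$ and $a>0$ with $\bar\nu(x)\sim a\overline{H_\#}(x)$ and $$\overline{H_\#}(x)=\exp\Bigl(-\int_{x_0}^x\frac{du}{h(u)}\Bigr),\quad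 x>x_0,$$ where the auxiliary function $h$ is positive and absolutely continuous on $(x_0,\infty)$ with density $h'>0$, $h'(u)\to0$, and $\lim_{b\downarrow1}\limsup_{x\to\infty}h(bx)/h(x)=1$. With $G(x)=(1/(1-H_\#))^{\leftarrow}(x)$, for some $x_1>e$, $G(x)=\exp\{\int_e^x\frac{\zeta(u)}{u\log u}du\}$ for $x>x_1$, where $\zeta$ satisfies: (B1) $\zeta(x)\asymp\sup_{u\in[1,x]}\zeta(u)$; (B2) for some $\delta>0$, $(\log\log u)^\delta\ll\zeta(u)\lesssim\frac{\log u}{\log\log u}$; (B3) for this $\delta$ and all small $\rho>0$, $\zeta\bigl(x^{1-\rho/(\log\log x)^{\delta\wedge1}}\bigr)\gtrsim\zeta(x)$; (B4) for any $c>0$, $\liminf_{x\to\infty}\int_{x^{1-c/\zeta(x)}}^x\frac{\zeta(u)}{u\log u}du>0$. *)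

(* Defs.v *)
From HB Require Import structures.
From mathcomp Require Import all_boot all_order all_algebra.
From mathcomp Require Import all_classical all_reals all_analysis.

Set Implicit Arguments.
Unset Strict Implicit.
Unset Printing Implicit Defensive.
Import Order.TTheory GRing.Theory Num.Theory.
Import numFieldNormedType.Exports.
Local Open Scope classical_set_scope.
Local Open Scope ring_scope.

Section asymptotics.
Variable R : realType.

Definition asymp_equiv (f g : R -> R) : Prop := f x / g x @[x --> +oo] --> (1 : R).

Definition asymp_gg (f g : R -> R) : Prop := f x / g x @[x --> +oo] --> +oo.

(* Extended real values, so that a supremum which is a priori infinite can
   appear on either side. *)
Definition asymp_le (f g : R -> \bar R) : Prop :=
  exists2 C : R, 0 < C & \forall x \near +oo, (f x <= C%:E * g x)%E.

Definition asymp_both (f g : R -> \bar R) : Prop := asymp_le f g /\ asymp_le g f.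

(* As usual for regular variation, L is measurable and eventually positive. *)
Definition slowly_varying (L : R -> R) : Prop :=
  [/\ measurable_fun (`]0, +oo[ : set (measurableTypeR R)) L,
      \forall x \near +oo, 0 < L x &
      forall c, 0 < c -> asymp_equiv (fun x => L (c * x)) L].

Definition geninv (J : R -> \bar R) (y : R) : \bar R :=
  ereal_inf [set s%:E | s in [set s | (y%:E <= J s)%E]].

End asymptotics.

Section line_measures.
Variable R : realType.
Local Notation RR := (measurableTypeR R).

Definition tail (nu : set RR -> \bar R) (x : R) : R := fine (nu `]x, +oo[%classic).

(* The generalized inverse of 1 / nu(x, oo).  The reciprocal is taken in \bar R,
   with 1 / 0 = +oo and 1 / +oo = 0. *)
Definition tail_quantile (nu : set RR -> \bar R) (y : R) : R :=
  fine (geninv (fun s => (nu `]s, +oo[%classic)^-1)%E y).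

Definition levy_measure (nu : {measure set RR -> \bar R}) : Prop :=
  nu [set 0] = 0%E /\ (\int[nu]_x (Num.min 1 (x ^+ 2))%:E < +oo)%E.

Definition subexponential (H : probability RR R) : Prop :=
  fine ((H \x H)%E [set z | x < z.1 + z.2]) / tail H x @[x --> +oo] --> (2 : R).

Definition gumbel_domain (H : probability RR R) : Prop :=
  exists a b : nat -> R, (forall n, 0 < a n) /\
    forall x, fine (H `]-oo, (a n * x + b n)]%classic) ^+ n @[n --> \oo]
                --> expR (- expR (- x)).

Lemma measurable_above_one : measurable (`]1, +oo[%classic : set RR).
Proof. exact: measurable_itv. Qed.

(* nu( . cap (1,oo)) / nu((1,oo)); the Dirac mass is the value that mnormalize
   takes when nu((1,oo)) is 0 or +oo. *)
Definition normalized_jumps (nu : {measure set RR -> \bar R}) : probability RR R :=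
  mnormalize (mrestr nu measurable_above_one) (dirac (0 : RR)).

End line_measures.

Section assumption_A2.
Variable R : realType.
Local Notation RR := (measurableTypeR R).
Local Notation leb := (@lebesgue_measure R).

(* The second clause is the absolute continuity of h on (x0, oo), dh being the
   density. *)
Definition auxiliary_function (x0 : R) (h dh : R -> R) : Prop :=
  [/\ forall u, x0 < u -> 0 < h u /\ 0 < dh u,
      forall x y, x0 < x -> x <= y ->
        leb.-integrable `[x, y] (EFin \o dh) /\
        h y - h x = \int[leb]_(u in `[x, y]) dh u,
      dh u @[u --> +oo] --> (0 : R) &
      limf_esup (fun x : R => (h (b * x) / h x)%:E) +oo_R @[b --> (1 : R)^'+]
        --> (1 : R)%:E].

(* The integral is taken in \bar R, so that no integrability of 1 / h near x0 is
   presupposed. *)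
Definition von_mises_tail (Hs : probability RR R) (x0 : R) (h : R -> R) : Prop :=
  forall x, x0 < x ->
    Hs `]x, +oo[%classic = expeR (- \int[leb]_(u in `]x0, x]) ((h u)^-1)%:E)%E.

Definition quantile_density (zeta : R -> R) (u : R) : R := zeta u / (u * ln u).

Definition quantile_repr (G zeta : R -> R) (x1 : R) : Prop :=
  [/\ expR 1 < x1,
      forall x, expR 1 < x ->
        leb.-integrable `[expR 1, x] (EFin \o quantile_density zeta) &
      forall x, x1 < x ->
        G x = expR (\int[leb]_(u in `[expR 1, x]) quantile_density zeta u)].

Definition condB1 (zeta : R -> R) : Prop :=
  asymp_both (EFin \o zeta)
    (fun x => ereal_sup [set (zeta u)%:E | u in `[1, x]]).

Definition condB2 (zeta : R -> R) (delta : R) : Prop :=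
  asymp_gg zeta (fun u => ln (ln u) `^ delta) /\
  asymp_le (EFin \o zeta) (fun u => (ln u / ln (ln u))%:E).

Definition condB3 (zeta : R -> R) (delta : R) : Prop :=
  exists2 rho0 : R, 0 < rho0 & forall rho, 0 < rho < rho0 ->
    asymp_le (EFin \o zeta)
      (fun x => (zeta (x `^ (1 - rho / ln (ln x) `^ Num.min delta 1)))%:E).

Definition condB4 (zeta : R -> R) : Prop :=
  forall c, 0 < c ->
    (0 < limf_einf (fun x : R =>
       (\int[leb]_(u in `[x `^ (1 - c / zeta x), x]) quantile_density zeta u)%:E)
       +oo_R)%E.

Definition assumption_A2 (nu : {measure set RR -> \bar R}) (h : R -> R) : Prop :=
  [/\ subexponential (normalized_jumps nu),
      gumbel_domain (normalized_jumps nu) &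
      exists (Hs : probability RR R) (a x0 : R) (dh : R -> R),
        [/\ 0 < a,
            asymp_equiv (tail nu) (fun x => a * tail Hs x),
            auxiliary_function x0 h dh,
            von_mises_tail Hs x0 h &
            exists (x1 : R) (zeta : R -> R) (delta : R),
              [/\ quantile_repr (tail_quantile Hs) zeta x1,
                  0 < delta,
                  condB1 zeta,
                  condB2 zeta delta &
                  condB3 zeta delta /\ condB4 zeta]]].

End assumption_A2.

HB.instance Definition _ := isPointed.Build int 0.

Definition coordinate_events : set (set (int -> int)) :=
  [set [set y : int -> int | y tj.1 = tj.2] | tj in [set: int * int]].

(* Z^Z with the product sigma-algebra *)
Notation path_space := (g_sigma_algebraType coordinate_events).

Section markov_chain.
Variable R : realType.

Definition transition_matrix (p : int -> int -> R) : Prop :=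
  (forall i j, 0 <= p i j) /\
  (forall i, \esum_(j in [set: int]) (p i j)%:E = 1%E).

Fixpoint transition_power (p : int -> int -> R) (n : nat) (i j : int) : \bar R :=
  if n is n'.+1
  then \esum_(k in [set: int]) ((p i k)%:E * transition_power p n' k j)%E
  else (i == j)%:R%:E.

Definition irreducible_chain (p : int -> int -> R) : Prop :=
  forall i j, exists n, (0 < transition_power p n i j)%E.

Definition aperiodic_chain (p : int -> int -> R) : Prop :=
  forall (i : int) (d : nat),
    (forall n, (0 < n)%N -> (0 < transition_power p n i i)%E -> (d %| n)%N) ->
    d = 1%N.

Definition invariant_measure (p : int -> int -> R) (q : int -> R) : Prop :=
  (forall i, 0 <= q i) /\
  (forall j, \esum_(i in [set: int]) (q i * p i j)%:E = (q j)%:E).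

Definition unique_invariant_measure (p : int -> int -> R) (q : int -> R) : Prop :=
  [/\ invariant_measure p q, q 0 = 1 &
      forall q', invariant_measure p q' -> q' 0 = 1 -> q' = q].

(* The two-sided chain given Y_0 = i: the past is run by the dual transition
   probabilities q_j p(j, k) / q_k.  Hence the path x_{-m}, ..., x_n with
   x_0 = i has probability
     q(x_{-m}) / q(i) * p(x_{-m}, x_{-m+1}) * ... * p(x_{n-1}, x_n). *)
Definition two_sided_law (p : int -> int -> R) (q : int -> R) (i : int)
    (Q : probability path_space R) : Prop :=
  forall (m n : nat) (x : int -> int),
    Q [set y | forall k : int, (- m%:Z <= k <= n%:Z)%R -> y k = x k] =
    (if x 0 == i
     then q (x (- m%:Z)) / q i *
          \prod_(k < (m + n)%N) p (x (k%:Z - m%:Z)) (x (k%:Z - m%:Z + 1))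
     else 0)%:E.

Definition hitting_time (i : int) (y : path_space) : \bar R :=
  ereal_inf [set t%:R%:E | t in [set t : nat | (1 <= t)%N /\ y t%:Z = i]].

Definition null_recurrent (P : int -> probability path_space R) : Prop :=
  forall i, P i [set y | (hitting_time i y < +oo)%E] = 1%E /\
            (\int[P i]_y hitting_time i y = +oo)%E.

Definition path_measure (q : int -> R) (P : int -> probability path_space R)
    (A : set path_space) : \bar R :=
  \esum_(i in [set: int]) ((q i)%:E * P i A)%E.

Definition wandering_rate (q : int -> R) (P : int -> probability path_space R)
    (n : nat) : R :=
  fine (path_measure q P [set y | exists2 k : nat, (k <= n)%N & y k%:Z = 0]).

Definition return_tail (P : int -> probability path_space R) (n : nat) : R :=
  fine (P 0 [set y | (n%:R%:E < hitting_time 0 y)%E]).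

Definition return_prob (P : int -> probability path_space R) (n : nat) : R :=
  fine (P 0 [set y | hitting_time 0 y = n%:R%:E]).

Definition assumption_A1 (P : int -> probability path_space R) (beta : R) : Prop :=
  (exists2 L : R -> R, slowly_varying L &
     forall n : nat, (0 < n)%N ->
       return_tail P n = n%:R `^ (- beta) * L n%:R) /\
  has_ubound [set n%:R * return_prob P n / return_tail P n | n in [set: nat]].

End markov_chain.

(* V(1 / Fbar(n)) / a_n -> 0 with a_n = h(V(w_n)) *)
Definition negligible_jumps (R : realType) (q : int -> R)
    (P : int -> probability path_space R)
    (nu : {measure set (measurableTypeR R) -> \bar R}) (h : R -> R) : Prop :=
  tail_quantile nu (1 / return_tail P n) /
    h (tail_quantile nu (wandering_rate q P n)) @[n --> \oo] --> (0 : R).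

(* Main.v *)
Require Import Defs.
From HB Require Import structures.
From mathcomp Require Import all_boot all_order all_algebra.
From mathcomp Require Import all_classical all_reals all_analysis.
From mathcomp Require Import measurable_realfun ring lra.

Set Implicit Arguments.
Unset Strict Implicit.
Unset Printing Implicit Defensive.
Import Order.TTheory GRing.Theory Num.Theory.
Import numFieldNormedType.Exports.
Local Open Scope classical_set_scope.
Local Open Scope ring_scope.

(* For large x the tail of nu is exp(- (1 + o(1)) phi(log x)), with
   phi(l) = lambda l^gamma in (a) and phi(l) = rho exp(mu l^alpha) in (b), so that
   log V(y) is close to psi(log y), where psi is the inverse of phi.  Splitting at the
   last visit to 0 gives w_n = sum_(k <= n) Fbar(k); since Fbar(n) = n^(- beta + o(1)),
   w_n lies between n^(1 - beta + o(1)) and n + 1.  As h is nondecreasing, - log of the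
   tail of H_# grows over [x, y] by at least (y - x) / h(y) and at most (y - x) / h(x);
   this bounds h(V(w_n)) from below by V(w_n) / (C log n), and from above by
   exp(psi(K log n)) / log n for K large.  Hence everything is decided by whether
   psi(k2 z) - psi(k1 z) - log z, with k1 < k2 and z = log n, tends to +oo or to -oo.
   In (a) the difference of the psi's is a power of z; in (b) it has the order of
   (log z)^(1/alpha - 1), which beats log z for alpha < 1/2 and loses for alpha > 1/2. *)

(** * The wandering rate of the chain *)

(** Pickling turns the fibres into a disjoint sequence indexed by [nat], so countable additivity
    applies and [C] needs no sigma-algebra. *)
Lemma measure_countable_fibers d (T : measurableType d) (R : realType)
    (C : countType) (m : {measure set T -> \bar R}) (X : T -> C) (W : set C) :
  (forall s, measurable (X @^-1` [set s])) ->
  m (X @^-1` W) = \esum_(s in W) m (X @^-1` [set s]).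
Proof.
move=> mX.
pose F k := [set y | pickle (X y) = k].
have FE s : F (pickle s) = X @^-1` [set s].
  by apply/seteqP; split => y; rewrite /F /preimage /=; [move/(pcan_inj pickleK)|move=> ->].
have -> : X @^-1` W = \bigcup_(k in pickle @` W) F k.
  apply/seteqP; split => [y /= Wy|y [_ [s Ws <-]]].
    by exists (pickle (X y)) => //; exists (X y).
  by rewrite FE /= => yX; rewrite /preimage /= yX.
rewrite measure_bigcup; last 2 first.
- by move=> _ [s Ws <-]; rewrite FE.
- by move=> i j _ _ [y [/= <- <-]].
rewrite nneseries_esum//.
have -> : [set x | x \in [set pickle x | x in W]] = [set pickle x | x in W].
  by apply/seteqP; split => x /=; rewrite inE.
rewrite esum_image; first by apply: eq_esum => s _; rewrite FE.
by move=> s t _ _; exact: (pcan_inj pickleK).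
Qed.

Local Notation path_space := (g_sigma_algebraType coordinate_events).

Lemma measurable_coordinate (t i : int) :
  measurable ([set y : int -> int | y t = i] : set path_space).
Proof. by apply: sub_sigma_algebra; exists (t, i). Qed.

Lemma measurable_coordinate_set (t : int) (D : set int) :
  measurable ([set y : int -> int | D (y t)] : set path_space).
Proof.
have -> : [set y : int -> int | D (y t)] = \bigcup_(i in D) [set y | y t = i].
  by apply/seteqP; split => [y Dy|y [i Di /= ->]//]; exists (y t).
have -> : \bigcup_(i in D) [set y : int -> int | y t = i] =
  \bigcup_(i : int) (if i \in D then [set y : int -> int | y t = i] else set0).
  apply/seteqP; split => [y [i Di yi]|y [i _]].
    by exists i => //; rewrite mem_set.
  by case: ifPn => // /set_mem Di yi; exists i.
apply: (@countable_bigcupT_measurable _ path_space int); first exact: countableP.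
by move=> i; case: ifP => _; [exact: measurable_coordinate|exact: measurable0].
Qed.

Section words.
Variable N : nat.

(** Letter [m] of the word sits at time 0. Reading one and the same set of words with different [m]
    is how time shifts are expressed below. *)
Definition window (m : nat) (y : int -> int) : {ffun 'I_N.+1 -> int} :=
  [ffun j : 'I_N.+1 => y (j%:Z - m%:Z)].

Lemma measurable_window (m : nat) (s : {ffun 'I_N.+1 -> int}) :
  measurable ((window m @^-1` [set s]) : set path_space).
Proof.
have -> : window m @^-1` [set s] =
  \bigcap_(j in [set: 'I_N.+1]) [set y : int -> int | y (j%:Z - m%:Z) = s j].
  apply/seteqP; split => [y /= <- j _|y ys]; first by rewrite /= ffunE.
  by apply/ffunP => j; rewrite ffunE; exact: ys.
apply: (@fin_bigcap_measurable _ path_space) => // j _.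
exact: measurable_coordinate.
Qed.

End words.

Lemma exchange_esum (R : realType) (S T : choiceType) (I : set S) (J : set T)
    (a : S -> T -> \bar R) : (forall i j, 0 <= a i j)%E ->
  \esum_(i in I) \esum_(j in J) a i j = \esum_(j in J) \esum_(i in I) a i j.
Proof.
move=> a0; rewrite !esum_esum//.
rewrite (@reindex_esum _ _ _ (J `*`` fun=> I) _ (fun z => (z.2, z.1)))//.
split => [[j i] [/= Jj Ii] //|[j i] [j' i'] _ _ [-> ->] //|[i j] [/= Ii Jj]].
by exists (j, i).
Qed.

Section chain.
Variables (R : realType) (p : int -> int -> R) (q : int -> R).
Variable P : int -> probability path_space R.
Hypothesis HP : forall i, two_sided_law p q i (P i).
Hypothesis q_ge0 : forall i, 0 <= q i.

(** The mass that [path_measure q P] gives to a word. The position of time 0 does not occur in it,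
    which is the source of shift invariance. *)
Definition word_weight N (s : {ffun 'I_N.+1 -> int}) : R :=
  q (s ord0) * \prod_(k < N) p (s (inord k)) (s (inord k.+1)).

Lemma window_probability (m n : nat) (i : int) (s : {ffun 'I_(m + n).+1 -> int}) :
  P i (window (m + n) m @^-1` [set s]) =
  (if s (inord m) == i
   then q (s ord0) / q i * \prod_(k < m + n) p (s (inord k)) (s (inord k.+1))
   else 0)%:E.
Proof.
pose x (k : int) := s (inord (absz (k + m%:Z))).
have -> : window (m + n) m @^-1` [set s] =
    [set y | forall k : int, (- m%:Z <= k <= n%:Z)%R -> y k = x k].
  apply/seteqP; split => y /=; rewrite /preimage /=.
    move=> ws k /andP[mk kn]; rewrite /x -ws ffunE; congr y.
    have [j jk] : exists j : nat, k + m%:Z = j%:Z.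
      by exists (absz (k + m%:Z)); rewrite gez0_abs // -lerBlDr sub0r.
    rewrite jk absz_nat inordK -?jk ?addrK //.
    by rewrite ltnS -lez_nat -jk PoszD addrC lerD2l.
  move=> yx; apply/ffunP => j; rewrite ffunE yx /x ?subrK ?absz_nat ?inord_val //.
  rewrite lerBrDr addNr lez_nat leq0n /= lerBlDr [n%:Z + _]addrC -PoszD lez_nat.
  exact: (ltn_ord j).
rewrite HP; congr (_%:E).
rewrite /x add0r absz_nat addNr absz0.
have -> : inord 0 = ord0 :> 'I_(m + n).+1 by apply/val_inj; rewrite /= inordK.
case: ifP => // _; congr (_ * _); apply: eq_bigr => k _.
by rewrite subrK addrAC subrK -PoszD !absz_nat addn1.
Qed.

(** Division by 0 gives 0, so [q i = 0] would make the two-sided law give mass 0 to every one-letter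
    word, against total mass 1. *)
Lemma invariant_weight_neq0 (i : int) : q i != 0.
Proof.
apply/eqP => qi0.
have : P i setT = 1%E := probability_setT (P i).
have -> : [set: path_space] = window 0 0 @^-1` setT by [].
rewrite measure_countable_fibers; last by move=> s; exact: measurable_window.
rewrite esum1 => [/eqP|s _]; first by rewrite eq_sym onee_eq0.
apply: etrans (window_probability (m := 0) (n := 0) i s) _.
by rewrite qi0 invr0 mulr0 mul0r if_same.
Qed.

(** Only the law started at the letter [s (inord m)] charges the word [s], and its weight cancels
    the division by [q i] in the two-sided law. So the result does not depend on how [m + n] splits
    into past and future. *)
Lemma path_measure_window (m n : nat) (W : set {ffun 'I_(m + n).+1 -> int}) :
  path_measure q P (window (m + n) m @^-1` W) = \esum_(s in W) (word_weight s)%:E.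
Proof.
pose M i : {measure set path_space -> \bar R} := mscale (NngNum (q_ge0 i)) (P i).
have -> : path_measure q P (window (m + n) m @^-1` W) =
    \esum_(i in [set: int]) M i (window (m + n) m @^-1` W) by [].
transitivity (\esum_(i in [set: int]) \esum_(s in W) M i (window _ m @^-1` [set s])).
  apply: eq_esum => i _; rewrite measure_countable_fibers// => s.
  exact: measurable_window.
rewrite exchange_esum//; apply: eq_esum => s _.
have ME i : M i (window (m + n) m @^-1` [set s]) =
    ((q i)%:E * (if s (inord m) == i
       then q (s ord0) / q i * \prod_(k < m + n) p (s (inord k)) (s (inord k.+1))
       else 0)%:E)%E by rewrite -window_probability.
rewrite (esumID [set (s (inord m) : int)])// setTI esum_set1//.
rewrite esum1 ?adde0; last first.
  by move=> i [_ /= /eqP si]; rewrite ME eq_sym (negbTE si) mule0.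
rewrite ME eqxx -EFinM /word_weight; congr (_%:E).
by rewrite mulrA mulrCA divff ?mulr1 ?invariant_weight_neq0.
Qed.

Let at0 : set path_space := [set y | y 0 = 0].
Definition avoid0 (n : nat) : set path_space :=
  [set y | forall k : nat, (0 < k <= n)%N -> y k%:Z <> 0].
Definition visit0 (n : nat) : set path_space :=
  [set y | exists2 k : nat, (k <= n)%N & y k%:Z = 0].
Let late_visit0 (n : nat) : set path_space :=
  [set y | exists2 k : nat, (0 < k <= n)%N & y k%:Z = 0].

Lemma measurable_avoid0 n : measurable (avoid0 n).
Proof.
have -> : avoid0 n =
    \bigcap_(k in [set k : nat | (0 < k <= n)%N]) [set y | (~` [set 0]) (y k%:Z)].
  by apply/seteqP; split => y.
apply: bigcap_measurableType => k _; exact: measurable_coordinate_set.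
Qed.

Lemma measurable_late_visit0 n : measurable (late_visit0 n).
Proof.
have -> : late_visit0 n =
    \bigcup_(k in [set k : nat | (0 < k <= n)%N]) [set y | y k%:Z = 0].
  by apply/seteqP; split => y [k kn yk]; exists k.
apply: bigcup_measurable => k _; exact: measurable_coordinate.
Qed.

Lemma start_probability (i j : int) : P i [set y | y 0 = j] = ((i == j)%:R)%:E.
Proof.
have -> : [set y : path_space | y 0 = j] =
    window (0 + 0) 0 @^-1` [set [ffun=> j]].
  apply/seteqP; split => y; rewrite /preimage /=.
    by move=> yj; apply/ffunP => k; rewrite !ffunE ord1 subrr.
  by move/ffunP/(_ ord0); rewrite !ffunE subrr.
apply: etrans (window_probability (m := 0) (n := 0) i _) _.
rewrite !ffunE big_ord0 mulr1 eq_sym; congr (_%:E).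
by case: eqP => [->|//]; rewrite divff ?invariant_weight_neq0.
Qed.

Hypothesis q0 : q 0 = 1.

(** Under [P i] the path starts at [i] almost surely, so [at0] kills every term but [i = 0]; there
    it is almost sure and the weight is 1. *)
Lemma path_measure_at0 (A : set path_space) : measurable A ->
  path_measure q P (at0 `&` A) = P 0 A.
Proof.
move=> mA; have mat0 : measurable at0 by exact: measurable_coordinate.
rewrite /path_measure (esumID [set 0 : int]); last first.
  by move=> i _; rewrite mule_ge0// lee_fin.
rewrite setTI esum_set1; last by rewrite mule_ge0// lee_fin.
rewrite esum1 ?adde0.
  rewrite q0 mul1e; apply/eqP; rewrite eq_le; apply/andP; split.
    by apply: le_measure; rewrite ?inE//; exact: measurableI.
  have n0 : P 0 (~` at0) = 0%E.
    by rewrite probability_setC// start_probability eqxx subee.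
  rewrite -[leRHS]adde0 -n0 -measureU//.
  - apply: le_measure; rewrite ?inE//.
      by apply: measurableU; [exact: measurableI|exact: measurableC].
    by move=> y Ay; have [?|?] := pselect (at0 y); [left|right].
  - exact: measurableI.
  - exact: measurableC.
  - by apply/seteqP; split => y // [[]].
move=> i [_ /= /eqP i0]; apply/eqP; rewrite mule_eq0; apply/orP; right.
rewrite eq_le measure_ge0 andbT.
have <- : P i at0 = 0%E by rewrite start_probability (negbTE i0).
by apply: le_measure; rewrite ?inE//; exact: measurableI.
Qed.

(** Shift invariance by one step: both events are the same set [W] of words of length [n + 2], read
    once with no past letter and once with one. *)
Lemma path_measure_late_visit0 n :
  path_measure q P (late_visit0 n.+1) = path_measure q P (visit0 n).
Proof.
pose W := [set s : {ffun 'I_n.+2 -> int} | exists2 k : 'I_n.+2, (0 < k)%N & s k = 0].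
have -> : late_visit0 n.+1 = window (0 + n.+1) 0 @^-1` W.
  apply/seteqP; split => y; rewrite /preimage /W /= => -[k].
    move=> /andP[k0 kn] yk; have kn2 : (k < n.+2)%N by [].
    by exists (Ordinal kn2) => //; rewrite ffunE subr0.
  move=> k0; rewrite ffunE subr0 => yk; exists k => //.
  by rewrite k0 -ltnS; exact: ltn_ord k.
have -> : visit0 n = window (1 + n) 1 @^-1` W.
  apply/seteqP; split => y; rewrite /preimage /W /= => -[k].
    move=> kn yk; have kn2 : (k.+1 < n.+2)%N by [].
    by exists (Ordinal kn2) => //; rewrite ffunE /= -addn1 PoszD addrK.
  case: k => -[|k] kn // _; rewrite ffunE /= -addn1 PoszD addrK => yk.
  by exists k.
apply: etrans (path_measure_window (m := 0) (n := n.+1) W) _.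
exact: esym (path_measure_window (m := 1) (n := n) W).
Qed.

(** A path visiting 0 in [[0, n + 1]] either does so after time 0, which by the shift has the mass
    of [visit0 n], or has its only visit at time 0, which contributes [P 0 (avoid0 n.+1)]. *)
Lemma path_measure_visit0 n :
  path_measure q P (visit0 n) = (\sum_(k < n.+1) P 0 (avoid0 k))%E.
Proof.
elim: n => [|n IHn].
  rewrite big_ord1 -path_measure_at0; last exact: measurable_avoid0.
  congr path_measure; apply/seteqP; split => y.
    case=> k; rewrite leqn0 => /eqP -> y0; split => // j.
    by case: j.
  by move=> [y0 _]; exists 0.
rewrite big_ord_recr /= -IHn -(path_measure_late_visit0 n).
rewrite -path_measure_at0; last exact: measurable_avoid0.
rewrite -esumD; try by move=> i _ /=; rewrite mule_ge0// lee_fin.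
apply: eq_esum => i _; rewrite -muleDr//; last first.
  by rewrite ge0_adde_def ?inE.
rewrite -measureU.
- congr (_ * P i _)%E; apply/seteqP; split => y.
    move=> [k kn yk]; have [late|nlate] := pselect (late_visit0 n.+1 y); first by left.
    right; split.
      case: k kn yk => // k kn yk; exfalso; apply: nlate; exists k.+1 => //.
    by move=> j jn yj; apply: nlate; exists j.
  move=> [[k /andP[_ kn] yk]|[y0 _]]; first by exists k.
  by exists 0.
- exact: measurable_late_visit0.
- by apply: measurableI; [exact: measurable_coordinate|exact: measurable_avoid0].
- by apply/seteqP; split => y // [[k kn yk] [_ /(_ k kn)]].
Qed.

Lemma return_tailE n : return_tail P n = fine (P 0 (avoid0 n)).
Proof.
rewrite /return_tail; congr (fine (P 0 _)); apply/seteqP; split => y /=.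
  move=> nh k /andP[k0 kn] yk.
  suff : (hitting_time R 0 y <= n%:R%:E)%E by rewrite leNgt nh.
  apply: (@le_trans _ _ (k%:R%:E)); last by rewrite lee_fin ler_nat.
  by apply: ereal_inf_lbound; exists k.
move=> yn; apply: (@lt_le_trans _ _ (n.+1%:R%:E)); first by rewrite lte_fin ltr_nat.
apply: le_ereal_inf_tmp => _ [k [k0 yk] <-]; rewrite lee_fin ler_nat ltnNge.
by apply/negP => kn; apply: (yn k) => //; rewrite k0.
Qed.

Lemma return_tail_nonincreasing (m n : nat) :
  (m <= n)%N -> return_tail P n <= return_tail P m.
Proof.
move=> mn; rewrite !return_tailE fine_le ?fin_num_measure//;
  try exact: measurable_avoid0.
apply: le_measure; rewrite ?inE; try exact: measurable_avoid0.
by move=> y yn k /andP[k0 km]; apply: yn; rewrite k0 (leq_trans km).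
Qed.

Lemma return_tail_le1 n : return_tail P n <= 1.
Proof.
rewrite return_tailE -lee_fin fineK ?fin_num_measure ?probability_le1//;
  exact: measurable_avoid0.
Qed.

Lemma wandering_rateE n : wandering_rate q P n = \sum_(k < n.+1) return_tail P k.
Proof.
rewrite /wandering_rate -/(visit0 n) path_measure_visit0 -sum_fine.
  by apply: eq_bigr => k _; rewrite return_tailE.
by move=> k _; rewrite fin_num_measure//; exact: measurable_avoid0.
Qed.

Lemma wandering_rate_ge n : n.+1%:R * return_tail P n <= wandering_rate q P n.
Proof.
rewrite wandering_rateE mulr_natl -[in leLHS](card_ord n.+1) -sumr_const.
by apply: ler_sum => k _; apply: return_tail_nonincreasing; rewrite -ltnS.
Qed.

Lemma wandering_rate_le n : wandering_rate q P n <= n.+1%:R.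
Proof.
rewrite wandering_rateE -[in leRHS](card_ord n.+1) -sumr_const.
by apply: ler_sum => k _; exact: return_tail_le1.
Qed.

End chain.

(** * Regular variation along the integers *)

Lemma ln_natr_pinfty (R : realType) : @ln R n%:R @[n --> \oo] --> +oo.
Proof.
apply/cvgryPge => A; near=> n.
have n_ge : expR A <= n%:R by near: n; exact: nbhs_infty_ger.
by rewrite -[A]expRK ler_ln// posrE (lt_le_trans (expR_gt0 A)).
Unshelve. all: by end_near. Qed.

(* Monotonicity reduces the Potter bounds to the dyadic subsequence, where they
   follow from [L (2 x) / L x --> 1] alone, without uniform convergence. *)
Lemma regular_variation_ln_bounds (R : realType) (F : nat -> R) (L : R -> R) (beta : R) :
  (forall m n, (m <= n)%N -> F n <= F m) ->
  (forall n, (0 < n)%N -> F n = n%:R `^ (- beta) * L n%:R) ->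
  slowly_varying L ->
  (\forall n \near \oo, 0 < F n) /\
  forall eps, 0 < eps <= beta -> \forall n \near \oo,
    - (beta + eps) * ln n%:R <= ln (F n) <= - (beta - eps) * ln n%:R.
Proof.
move=> Fmono FE [_ Lpos /(_ _ (ltr0Sn R 1)) L2].
have Fpos : \forall n \near \oo, 0 < F n.
  case: Lpos => A [_ LA]; near=> n.
  have n0 : (0 < n)%N by near: n; exact: nbhs_infty_gt.
  rewrite FE// mulr_gt0// ?powR_gt0 ?ltr0n//; apply: LA.
  by near: n; exact: nbhs_infty_gtr.
split => // eps /andP[eps0 epsb].
pose a k := ln (F (2 ^ k)%N).
have l2 : 0 < ln (2 : R) by rewrite ln_gt0// ltr1n.
have F2 : forall n, 0 < F n.
  move=> n; case: Fpos => N _ FN.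
  by apply: lt_le_trans (Fmono n (maxn n N) (leq_maxl _ _)); apply: FN => /=; exact: leq_maxr.
(* An increment of [a] is [- beta * ln 2] plus the logarithm of [L (2 x) / L x], which tends to 0.
   Only half of [eps] is spent here. *)
have step : \forall k \near \oo,
    - (beta + eps / 2) * ln 2 <= a k.+1 - a k <= - (beta - eps / 2) * ln 2.
  pose e := (eps / 2) * ln 2.
  have e0 : 0 < e by rewrite mulr_gt0// divr_gt0.
  have lnL : ln (L (2 * x) / L x) @[x --> +oo] --> (0 : R).
    rewrite -(ln1 R); apply: continuous_cvg; last exact: L2.
    by apply: continuous_ln.
  have : \forall x \near +oo, `|ln (L (2 * x) / L x)| < e.
    by move/cvgr0_norm_lt : lnL => /(_ _ e0).
  case=> A [_ HA]; near=> k.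
  have Ak : A < (2 ^ k)%N%:R.
    rewrite (@lt_le_trans _ _ k%:R)//; first by near: k; exact: nbhs_infty_gtr.
    by rewrite ler_nat ltnW// ltn_expl.
  have k0 : (0 < 2 ^ k)%N by rewrite expn_gt0.
  have k1 : (0 < 2 ^ k.+1)%N by rewrite expn_gt0.
  have aE : a k.+1 - a k = - beta * ln 2 + ln (L (2 * (2 ^ k)%N%:R) / L (2 ^ k)%N%:R).
    have pk : 0 < (2 ^ k)%N%:R :> R by rewrite ltr0n.
    have pw (x : R) : 0 < x -> 0 < x `^ (- beta) by exact: powR_gt0.
    rewrite /a -ln_div ?posrE//.
    rewrite !FE// expnS natrM.
    set y := (2 ^ k)%N%:R in pk *.
    have Ly : 0 < L y.
      by have := F2 (2 ^ k)%N; rewrite FE// pmulr_rgt0// pw.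
    have L2y : 0 < L (2 * y).
      by have := F2 (2 ^ k.+1)%N; rewrite FE// pmulr_rgt0 ?pw// expnS natrM// mulr_gt0.
    rewrite powRM ?ltW// invfM.
    have -> : 2 `^ (- beta) * y `^ (- beta) * L (2 * y) * ((y `^ (- beta))^-1 * (L y)^-1)
       = 2 `^ (- beta) * (L (2 * y) / L y).
      by field; rewrite !gt_eqF ?pw.
    by rewrite lnM ?posrE ?powR_gt0 ?divr_gt0// ln_powR.
  have := HA _ Ak; rewrite aE ltr_norml /e => /andP[H1 H2].
  by apply/andP; split; lra.
case: step => K _ step.
have bnd j : a K - j%:R * ((beta + eps / 2) * ln 2) <= a (K + j)%N <=
             a K - j%:R * ((beta - eps / 2) * ln 2).
  elim: j => [|j /andP[IH1 IH2]]; first by rewrite addn0 !mul0r subr0 lexx.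
  have /andP[] := step (K + j)%N (leq_addr _ _).
  by rewrite addnS -(natr1 j) => s1 s2; apply/andP; split; lra.
(* [C] gathers what does not grow with [n]: the initial value, the [K] skipped steps, and the one
   step lost by rounding [n] to a power of 2. The other half of [eps] absorbs it. *)
pose C := `|a K| + (K%:R + 1) * ((beta + eps / 2) * ln 2).
near=> n.
have n0 : (0 < n)%N by near: n; exact: nbhs_infty_gt.
have nK : (2 ^ K <= n)%N by near: n; exact: nbhs_infty_ge.
have lnC : C <= (eps / 2) * ln n%:R.
  rewrite mulrC -ler_pdivrMr ?divr_gt0//.
  by near: n; move/cvgryPge : (@ln_natr_pinfty R); apply.
have /= /andP[k1 k2] := trunc_log_bounds (isT : (1 < 2)%N) n0.
set k := trunc_log 2 n in k1 k2.
have Kk : (K <= k)%N by rewrite /k trunc_log_max.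
have /andP[_ b2] := bnd (k - K)%N; have /andP[b1 _] := bnd (k.+1 - K)%N.
rewrite subnKC// in b2; rewrite subnKC ?leqW// in b1.
rewrite natrB// in b2; rewrite natrB ?leqW// -(natr1 k) in b1.
have lnF1 : ln (F n) <= a k by rewrite ler_ln ?posrE//; exact: Fmono.
have lnF2 : a k.+1 <= ln (F n) by rewrite ler_ln ?posrE//; apply: Fmono; exact: ltnW.
have ln1 : k%:R * ln 2 <= ln n%:R :> R.
  by rewrite mulr_natl -lnXn// -natrX ler_ln ?posrE ?ltr0n ?expn_gt0// ler_nat.
have ln2 : ln n%:R <= (k%:R + 1) * ln 2 :> R.
  by rewrite natr1 mulr_natl -lnXn// -natrX ler_ln ?posrE ?ltr0n ?expn_gt0// ler_nat ltnW.
have aK1 : - `|a K| <= a K by rewrite lerNl -normrN ler_norm.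
have aK2 : a K <= `|a K| by exact: ler_norm.
have K0 : 0 <= K%:R :> R by [].
have be : 0 <= beta - eps / 2 by lra.
have b'0 : 0 <= beta + eps / 2 by lra.
have t1 := ler_wpM2l be ln2; have t2 := ler_wpM2l b'0 ln1.
have t3 : 0 <= K%:R * ((beta + eps / 2) * ln 2) by rewrite !mulr_ge0// ltW.
have t4 : 0 <= (K%:R + 1) * (eps * ln 2).
  by rewrite !mulr_ge0 ?addr_ge0// ltW.
have t5 : 0 <= (beta + eps / 2) * ln 2 by rewrite mulr_ge0// ltW.
rewrite /C in lnC.
apply/andP; split; lra.
Unshelve. all: by end_near. Qed.

(** * Tails, quantiles and auxiliary functions *)

Section tails.
Variable R : realType.
Local Notation RR := (measurableTypeR R).

(** [fine] sends infinite values to 0, so a positive [tail] certifies finite mass. Positivity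
    hypotheses below serve this purpose. *)
Lemma tail_gt0E (nu : set RR -> \bar R) (x : R) :
  0 < tail nu x -> nu `]x, +oo[%classic = (tail nu x)%:E.
Proof. by rewrite /tail; case: (nu _) => //= [|]; rewrite ltxx. Qed.

Lemma tail_ge0 (nu : {measure set RR -> \bar R}) (x : R) : 0 <= tail nu x.
Proof. by rewrite /tail fine_ge0. Qed.

Lemma tail_nonincreasing (nu : {measure set RR -> \bar R}) (x y : R) :
  x <= y -> 0 < tail nu x -> tail nu y <= tail nu x.
Proof.
move=> xy Tx; rewrite -lee_fin -(tail_gt0E Tx).
have le_nu : (nu `]y, +oo[%classic <= nu `]x, +oo[%classic)%E.
  apply: le_measure; rewrite ?inE; [exact: measurable_itv..|].
  by apply: subset_itvr; rewrite bnd_simp.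
rewrite fineK// ge0_fin_numE// (le_lt_trans le_nu)// (tail_gt0E Tx) ltry//.
Qed.

Lemma le_geninvE (nu : {measure set RR -> \bar R}) (s y : R) : 0 < y ->
  (y%:E <= (nu `]s, +oo[%classic)^-1)%E = (nu `]s, +oo[%classic <= (y^-1)%:E)%E.
Proof.
move=> y0; rewrite inve_pge ?inE//; last by rewrite lee_fin ltW.
by rewrite inver gt_eqF.
Qed.

(** The point [x] belongs to the set whose infimum is taken. The condition [0 <= x] covers an
    infimum equal to -oo, which [fine] reads as 0. *)
Lemma tail_quantile_le (nu : {measure set RR -> \bar R}) (x y : R) :
  0 <= x -> 0 < y -> 0 < tail nu x <= y^-1 -> tail_quantile nu y <= x.
Proof.
move=> x0 y0 /andP[Tx Txy]; rewrite /tail_quantile.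
have : (geninv (fun s => (nu `]s, +oo[%classic)^-1)%E y <= x%:E)%E.
  by apply: ereal_inf_lbound; exists x => //=; rewrite le_geninvE// tail_gt0E.
by case: (geninv _ _).
Qed.

(** The strict inequality at [x] keeps the whole set to the right of [x]. The point [x'] makes the
    set nonempty, since [fine] would turn an infimum +oo into 0. *)
Lemma tail_quantile_ge (nu : {measure set RR -> \bar R}) (x x' y : R) :
  0 < y -> y^-1 < tail nu x -> 0 < tail nu x' <= y^-1 -> x <= tail_quantile nu y.
Proof.
move=> y0 Tx /andP[Tx' Tx'y]; rewrite /tail_quantile.
have : (geninv (fun s => (nu `]s, +oo[%classic)^-1)%E y <= x'%:E)%E.
  by apply: ereal_inf_lbound; exists x' => //=; rewrite le_geninvE// tail_gt0E.
have : (x%:E <= geninv (fun s => (nu `]s, +oo[%classic)^-1)%E y)%E.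
  apply: le_ereal_inf_tmp => z [s /=]; rewrite le_geninvE// => nus <-.
  rewrite lee_fin leNgt; apply/negP => sx.
  have Tx0 : 0 < tail nu x by rewrite (lt_trans _ Tx)// invr_gt0.
  suff : (nu `]x, +oo[%classic <= (y^-1)%:E)%E.
    by rewrite (tail_gt0E Tx0) lee_fin leNgt Tx.
  apply: le_trans nus; apply: le_measure; rewrite ?inE; [exact: measurable_itv..|].
  by apply: subset_itvr; rewrite bnd_simp ltW.
by case: (geninv _ _).
Qed.

End tails.

Section von_mises.
Variables (R : realType) (Hs : probability (measurableTypeR R) R) (x0 : R) (h dh : R -> R).
Hypothesis Hh : auxiliary_function x0 h dh.
Hypothesis HT : von_mises_tail Hs x0 h.
Local Notation leb := (@lebesgue_measure R).

Lemma auxiliary_gt0 x : x0 < x -> 0 < h x.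
Proof. by case: Hh => /(_ x) + _ _ _ => /[apply] -[]. Qed.

Lemma auxiliary_nondecreasing x y : x0 < x -> x <= y -> h x <= h y.
Proof.
case: Hh => dh0 hE _ _ x0x xy; rewrite -subr_ge0.
have [_ ->] := hE _ _ x0x xy; apply: Rintegral_ge0 => u /=.
rewrite in_itv /= => /andP[xu _].
by have [_ /ltW] := dh0 u (lt_le_trans x0x xu).
Qed.

Let measurable_inv_auxiliary : measurable_fun (`]x0, +oo[ : set R) (fun u => ((h u)^-1)%:E).
Proof.
apply/measurable_EFinP.
(* Since [1 / h] is nonincreasing, preimages of closed rays are intervals. *)
apply: (measurability (@RGenCInfty.G R)) => [|/= _ [_] [r] -> <-].
  exact: RGenCInfty.measurableE.
apply: is_interval_measurable => s t /=.
rewrite !in_itv /= !andbT => -[sx rs] [tx rt] u /andP[su ut].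
have ux := lt_le_trans sx su.
rewrite !in_itv /= !andbT; split => //; apply: (le_trans rt).
by rewrite lef_pV2 ?posrE ?auxiliary_gt0// auxiliary_nondecreasing.
Qed.

(** The middle term is the integral of [1 / h] over []x, y]], and monotonicity of [h] bounds the
    integrand by its values at the two ends. *)
Lemma tail_log_ratio_bounds x y : x0 < x -> x <= y -> 0 < tail Hs y ->
  (y - x) / h y <= ln (tail Hs x) - ln (tail Hs y) <= (y - x) / h x.
Proof.
move=> x0x xy Ty.
pose I (i : interval R) := (\int[leb]_(u in [set` i]) ((h u)^-1)%:E)%E.
have sub (i : interval R) : [set` i] `<=` `]x0, +oo[%classic ->
    measurable_fun ([set` i] : set R) (fun u => ((h u)^-1)%:E).
  move=> ii; apply: measurable_funS measurable_inv_auxiliary => //.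
have pos (u : R) : x0 < u -> (0 <= ((h u)^-1)%:E)%E.
  by move=> ux; rewrite lee_fin invr_ge0 ltW// auxiliary_gt0.
have IE : I `]x0, y] = (I `]x0, x] + I `]x, y])%E.
  rewrite /I -ge0_integral_setU.
  - by congr integral; rewrite -itv_bndbnd_setU// bnd_simp// ltW.
  - exact: measurable_itv.
  - exact: measurable_itv.
  - rewrite -itv_bndbnd_setU ?bnd_simp// ?ltW//; apply: sub.
    by apply: subset_itvl; rewrite bnd_simp.
  - by move=> u /= []; rewrite in_itv /= => /andP[ux _]; apply: pos; rewrite // (lt_trans x0x).
  - apply/disj_setPS => u /= []; rewrite !in_itv /= => /andP[_ ux] /andP[xu _].
    by have := lt_le_trans xu ux; rewrite ltxx.
have xy0 u : u \in `]x, y] -> [/\ x0 < u, x <= u & u <= y].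
  by rewrite in_itv /= => /andP[xu ->]; rewrite (lt_trans x0x)// ltW.
have cst_int (r : R) : (\int[leb]_(u in `]x, y]) r%:E = ((y - x) * r)%:E)%E.
  rewrite integral_cst; last exact: measurable_itv.
  rewrite /= lebesgue_measure_itv /= lte_fin; case: ltgtP xy => // [_ _|-> _].
    by rewrite -EFinB -EFinM mulrC.
  by rewrite subrr mul0r mule0.
have mI : measurable_fun (`]x, y] : set R) (fun u => ((h u)^-1)%:E).
  by apply: sub => u /xy0[xu _ _]; rewrite /= in_itv /= andbT.
have hy0 : 0 < h y by rewrite auxiliary_gt0// (lt_le_trans x0x).
have Iub : (I `]x, y] <= ((y - x) / h x)%:E)%E.
  rewrite -cst_int; apply: ge0_le_integral => //.
  - by move=> u /xy0[ux _ _]; exact: pos.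
  - move=> u /xy0[x0u xu _].
    by rewrite lee_fin lef_pV2 ?posrE ?auxiliary_gt0// auxiliary_nondecreasing.
have Ilb : (((y - x) / h y)%:E <= I `]x, y])%E.
  rewrite -cst_int; apply: ge0_le_integral => //.
  - by move=> u _; rewrite lee_fin invr_ge0 ltW.
  - move=> u /xy0[x0u _ uy].
    by rewrite lee_fin lef_pV2 ?posrE ?hy0 ?auxiliary_gt0// auxiliary_nondecreasing.
have I1fin : I `]x, y] \is a fin_num.
  by rewrite ge0_fin_numE ?(le_lt_trans Iub) ?ltry//; apply: le_trans Ilb;
    rewrite lee_fin divr_ge0 ?subr_ge0// ltW// auxiliary_gt0// (lt_le_trans x0x).
have Ix0 : (0 <= I `]x0, x])%E.
  by apply: integral_ge0 => u /=; rewrite in_itv /= => /andP[ux _]; exact: pos.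
have HTy := HT (lt_le_trans x0x xy); have HTx := HT x0x.
move: Iub Ilb; rewrite -(fineK I1fin) !lee_fin => Iub Ilb.
(* An infinite integral near [x0] would make the tail at [y] equal to exp(-oo) = 0, against [Ty]; so
   it is finite and cancels in the difference. *)
have I2fin : I `]x0, x] \is a fin_num.
  rewrite ge0_fin_numE//; rewrite ltNge leye_eq; apply/negP => /eqP Iy.
  move: HTy; rewrite -/(I _) IE Iy -(fineK I1fin) /= (tail_gt0E Ty) => -[] Ty0.
  by rewrite Ty0 ltxx in Ty.
have Tx : tail Hs x = expR (- fine (I `]x0, x])).
  by rewrite /tail HTx -/(I _) -(fineK I2fin).
have TyE : tail Hs y = expR (- fine (I `]x0, x]) - fine (I `]x, y])).
  by rewrite /tail HTy -/(I _) IE -(fineK I2fin) -(fineK I1fin) /= opprD.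
rewrite Tx TyE !expRK opprD !opprK addKr.
by rewrite Ilb Iub.
Qed.

End von_mises.

(** * Quantiles against the auxiliary function *)

Section negligibility.
Variables (R : realType) (nu : {measure set (measurableTypeR R) -> \bar R}).
Variables (Hs : probability (measurableTypeR R) R) (a x0 : R) (h dh psi : R -> R).
Hypothesis a_gt0 : 0 < a.
Hypothesis nu_equiv : asymp_equiv (tail nu) (fun x => a * tail Hs x).
Hypothesis Hh : auxiliary_function x0 h dh.
Hypothesis HT : von_mises_tail Hs x0 h.
Hypothesis psi_pinfty : psi z @[z --> +oo] --> +oo.
(* [psi] is asymptotically the inverse of [- ln (tail nu (exp _))]. *)
Hypothesis tail_psi : - ln (tail nu (expR (psi z))) / z @[z --> +oo] --> (1 : R).

Lemma expR_psi_pinfty : expR (psi z) @[z --> +oo] --> +oo.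
Proof.
apply/cvgryPge => A; near=> z.
have := expR_ge1Dx (psi z); apply: le_trans.
have : A <= psi z by near: z; move/cvgryPge : psi_pinfty; apply.
lra.
Unshelve. all: by end_near. Qed.

Lemma near_scaled_ln (P : R -> Prop) k : 0 < k ->
  (\forall z \near +oo, P z) -> \forall n \near \oo, P (k * ln n%:R).
Proof.
move=> k0 [A [_ HA]]; near=> n; apply: HA.
rewrite mulrC -ltr_pdivrMr//; near: n.
by move/cvgryPgt : (@ln_natr_pinfty R); apply.
Unshelve. all: by end_near. Qed.

Lemma near_expR_psi (P : R -> Prop) :
  (\forall x \near +oo, P x) -> \forall z \near +oo, P (expR (psi z)).
Proof. exact: expR_psi_pinfty. Qed.

Let tails_gt0 : \forall x \near +oo, 0 < tail nu x /\ 0 < tail Hs x.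
Proof.
have : \forall x \near +oo, 0 < tail nu x / (a * tail Hs x).
  by apply: (cvgr_gt (1 : R)) => //; exact: nu_equiv.
(* Division by 0 gives 0, so a positive quotient forces both tails to be nonzero. *)
apply: filterS => x H; split; rewrite lt_neqAle tail_ge0 andbT eq_sym;
  apply/eqP => T0; move: H; rewrite T0.
  by rewrite mul0r ltxx.
by rewrite mulr0 invr0 mulr0 ltxx.
Qed.

Let tails_close : \forall x \near +oo,
  `|ln (tail nu x) - ln (tail Hs x) - ln a| < 1.
Proof.
have lnc : ln (tail nu x / (a * tail Hs x)) @[x --> +oo] --> (0 : R).
  rewrite -(ln1 R); apply: continuous_cvg; last exact: nu_equiv.
  by apply: continuous_ln.
have : \forall x \near +oo, `|ln (tail nu x / (a * tail Hs x))| < 1.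
  by move/cvgr0_norm_lt : lnc => /(_ _ ltr01).
apply: filterS2 tails_gt0 => x [T1 T2].
by rewrite ln_div ?posrE ?mulr_gt0// lnM ?posrE// opprD addrA addrAC.
Qed.

Let tail_nu_bounds k1 k2 : k1 < 1 -> 1 < k2 -> \forall z \near +oo,
  k1 * z <= - ln (tail nu (expR (psi z))) <= k2 * z.
Proof.
move=> k11 k21; near=> z.
have z0 : 0 < z by near: z; exact: nbhs_pinfty_gt.
apply/andP; split; [rewrite -ler_pdivlMr//|rewrite -ler_pdivrMr//]; apply: ltW; near: z.
- by apply: (cvgr_gt (1 : R)).
- by apply: (cvgr_lt (1 : R)).
Unshelve. all: by end_near. Qed.

Let tail_Hs_bounds k1 k2 : k1 < 1 -> 1 < k2 -> \forall z \near +oo,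
  k1 * z <= - ln (tail Hs (expR (psi z))) <= k2 * z.
Proof.
(* Half of the slack pays for the bounds on the tail of [nu]; the other half, at least [e * z],
   absorbs the bounded discrepancy [|ln a| + 1] between the two tails. *)
move=> k11 k21; pose e := Num.min ((1 - k1) / 2) ((k2 - 1) / 2).
have e0 : 0 < e by rewrite lt_min; apply/andP; split; lra.
have e1 : e <= (1 - k1) / 2 by rewrite ge_min lexx.
have e2 : e <= (k2 - 1) / 2 by rewrite ge_min lexx orbT.
near=> z.
have zA : (`|ln a| + 1) / e <= z by near: z; apply: nbhs_pinfty_ge; exact: num_real.
rewrite ler_pdivrMr// in zA.
have : (1 - e) * z <= - ln (tail nu (expR (psi z))) <= (1 + e) * z.
  by near: z; apply: tail_nu_bounds; lra.
have : `|ln (tail nu (expR (psi z))) - ln (tail Hs (expR (psi z))) - ln a| < 1.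
  near: z; exact: (near_expR_psi tails_close).
rewrite ltr_norml => /andP[c1 c2] /andP[b1 b2].
have la1 := ler_norm (ln a); have la2 := lerNnormlW (lexx `|ln a|).
have z0 : 0 < z by near: z; exact: nbhs_pinfty_gt.
have m1 := ler_wpM2r (ltW z0) e1; have m2 := ler_wpM2r (ltW z0) e2.
apply/andP; split; lra.
Unshelve. all: by end_near. Qed.

Let lnn_gt0 : \forall n \near \oo, 0 < ln n%:R :> R.
Proof. by move/cvgryPgt : (@ln_natr_pinfty R); apply. Qed.

(** At the point [expR (psi (k' * ln n))] the tail is n^(- k' (1 + o(1))), hence at most n^(- k).
    The tail bound is kept in the conclusion because [tail_quantile_lower] reuses it to show that
    the quantile is finite. *)
Lemma tail_quantile_upper (f : nat -> R) k k' : 0 < k -> k < k' ->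
  (\forall n \near \oo, 0 < f n /\ ln (f n) <= k * ln n%:R) ->
  \forall n \near \oo, 0 < tail nu (expR (psi (k' * ln n%:R))) <= (f n)^-1 /\
    tail_quantile nu (f n) <= expR (psi (k' * ln n%:R)).
Proof.
move=> k0 kk' Hf; have k'0 := lt_trans k0 kk'.
near=> n.
have [f0 fk] : 0 < f n /\ ln (f n) <= k * ln n%:R by near: n.
have l0 : 0 < ln n%:R :> R by near: n.
have Tx : 0 < tail nu (expR (psi (k' * ln n%:R))).
  near: n; apply: (near_scaled_ln (P := fun z => 0 < tail nu (expR (psi z)))) => //.
  apply: (near_expR_psi (P := fun x => 0 < tail nu x)).
  by apply: filterS tails_gt0 => x [].
have /andP[b1 _] : k / k' * (k' * ln n%:R) <=
    - ln (tail nu (expR (psi (k' * ln n%:R)))) <= 2 * (k' * ln n%:R).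
  near: n; apply: (near_scaled_ln (P := fun z => k / k' * z <=
    - ln (tail nu (expR (psi z))) <= 2 * z)) => //.
  by apply: tail_nu_bounds; rewrite ?ltr1n// ltr_pdivrMr ?mul1r.
rewrite mulrA divfK ?gt_eqF// in b1.
have Tf : tail nu (expR (psi (k' * ln n%:R))) <= (f n)^-1.
  by rewrite -ler_ln ?posrE ?invr_gt0// lnV ?posrE//; lra.
by rewrite Tx Tf; split => //; apply: tail_quantile_le; rewrite ?Tx// expR_ge0.
Unshelve. all: by end_near. Qed.

Lemma tail_quantile_lower (f : nat -> R) k k' K : 0 < k' -> k' < k ->
  (\forall n \near \oo, 0 < f n /\ k * ln n%:R <= ln (f n) <= K * ln n%:R) ->
  \forall n \near \oo, expR (psi (k' * ln n%:R)) <= tail_quantile nu (f n).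
Proof.
move=> k'0 k'k Hf; have k0 := lt_trans k'0 k'k.
(* A factor above 1 for [tail_nu_bounds] that still leaves [c * k'] below [k]: the midpoint of 1 and
   [k / k']. *)
have [c c1 ck] : exists2 c : R, 1 < c & c * k' < k.
  have r1 : 1 < k / k' by rewrite ltr_pdivlMr ?mul1r.
  have rk : k / k' * k' = k by rewrite divfK// gt_eqF.
  move: (k / k') r1 rk => r r1 rk.
  by exists ((1 + r) / 2); nra.
have Hup := tail_quantile_upper (f := f) (k := Num.max K 1) (k' := Num.max K 1 + 1).
near=> n.
have [f0 /andP[fk fK]] : 0 < f n /\ k * ln n%:R <= ln (f n) <= K * ln n%:R by near: n.
have l0 : 0 < ln n%:R :> R by near: n.
have [TK _] : 0 < tail nu (expR (psi ((Num.max K 1 + 1) * ln n%:R))) <= (f n)^-1 /\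
    tail_quantile nu (f n) <= expR (psi ((Num.max K 1 + 1) * ln n%:R)).
  near: n; apply: Hup; [by rewrite lt_max ltr01 orbT|by rewrite ltrDl|].
  near=> n; have [f0 /andP[fk fK]] : 0 < f n /\ k * ln n%:R <= ln (f n) <= K * ln n%:R by near: n.
  have l0 : 0 < ln n%:R :> R by near: n.
  by split => //; apply: (le_trans fK); rewrite ler_pM2r// le_max lexx.
have Tx : 0 < tail nu (expR (psi (k' * ln n%:R))).
  near: n; apply: (near_scaled_ln (P := fun z => 0 < tail nu (expR (psi z)))) => //.
  apply: (near_expR_psi (P := fun x => 0 < tail nu x)).
  by apply: filterS tails_gt0 => x [].
have /andP[_ b1] : 0 * (k' * ln n%:R) <=
    - ln (tail nu (expR (psi (k' * ln n%:R)))) <= c * (k' * ln n%:R).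
  near: n; apply: (near_scaled_ln (P := fun z => 0 * z <=
    - ln (tail nu (expR (psi z))) <= c * z)) => //.
  exact: tail_nu_bounds.
have b2 : c * (k' * ln n%:R) < k * ln n%:R.
  by rewrite mulrA ltr_pM2r.
apply: (tail_quantile_ge f0 _ TK).
by rewrite -ltr_ln ?posrE ?invr_gt0// lnV ?posrE//; lra.
Unshelve. all: by end_near. Qed.

Let psi_gt A k : 0 < k -> \forall n \near \oo, A < expR (psi (k * ln n%:R)).
Proof.
move=> k0; apply: (near_scaled_ln (P := fun z => A < expR (psi z))) => //.
by move/cvgryPgt : expR_psi_pinfty; apply.
Qed.

Let tail_Hs_scaled k : 0 < k -> \forall n \near \oo,
  0 < tail Hs (expR (psi (k * ln n%:R))) /\
  k / 2 * ln n%:R <= - ln (tail Hs (expR (psi (k * ln n%:R)))) <= 2 * k * ln n%:R.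
Proof.
move=> k0; near=> n; split.
  near: n; apply: (near_scaled_ln (P := fun z => 0 < tail Hs (expR (psi z)))) => //.
  apply: (near_expR_psi (P := fun x => 0 < tail Hs x)).
  by apply: filterS tails_gt0 => x [].
have : 2^-1 * (k * ln n%:R) <= - ln (tail Hs (expR (psi (k * ln n%:R)))) <= 2 * (k * ln n%:R).
  near: n; apply: (near_scaled_ln (P := fun z => 2^-1 * z <=
    - ln (tail Hs (expR (psi z))) <= 2 * z)) => //.
  by apply: tail_Hs_bounds; lra.
by rewrite !mulrA [2^-1 * _]mulrC.
Unshelve. all: by end_near. Qed.

(** Between [x0 + 1] and [X] the log-tail drops by at most [2 * k * ln n], so
    [tail_log_ratio_bounds] gives [X - (x0 + 1) <= 2 * k * ln n * h X]. The left side exceeds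
    [X / 2] once [X > 2 * (x0 + 1)]. *)
Lemma auxiliary_lower k : 0 < k -> \forall n \near \oo,
  expR (psi (k * ln n%:R)) <= 4 * k * ln n%:R * h (expR (psi (k * ln n%:R))).
Proof.
move=> k0; near=> n.
have l0 : 0 < ln n%:R :> R by near: n.
have [T0 /andP[_ T2]] : 0 < tail Hs (expR (psi (k * ln n%:R))) /\
  k / 2 * ln n%:R <= - ln (tail Hs (expR (psi (k * ln n%:R)))) <= 2 * k * ln n%:R.
  by near: n; exact: tail_Hs_scaled.
have X1 : x0 + 1 < expR (psi (k * ln n%:R)) by near: n; exact: psi_gt.
have X2 : 2 * (x0 + 1) < expR (psi (k * ln n%:R)) by near: n; exact: psi_gt.
set X := expR _ in T0 T2 X1 X2 *.
have x01 : x0 < x0 + 1 by rewrite ltrDl.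
have /andP[b _] := tail_log_ratio_bounds Hh HT x01 (ltW X1) T0.
have hX : 0 < h X by rewrite (auxiliary_gt0 Hh)// (lt_trans x01).
have T1 : ln (tail Hs (x0 + 1)) <= 0.
  apply: ln_le0; rewrite -lee_fin fineK ?probability_le1 ?fin_num_measure//.
rewrite ler_pdivrMr// in b.
have : (ln (tail Hs (x0 + 1)) - ln (tail Hs X)) * h X <= (2 * k * ln n%:R) * h X.
  by rewrite ler_pM2r//; lra.
lra.
Unshelve. all: by end_near. Qed.

(** The exponent [4 * k + 2] makes up for the factors 2 lost in [tail_Hs_scaled]: the log-tail drops
    by at least [(2 * k + 1) - 2 * k = 1] times [ln n] from [X] to [Y], whence
    [ln n * h X <= Y - X]. *)
Lemma auxiliary_upper k : 0 < k -> \forall n \near \oo,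
  h (expR (psi (k * ln n%:R))) * ln n%:R <= expR (psi ((4 * k + 2) * ln n%:R)).
Proof.
move=> k0; have K0 : 0 < 4 * k + 2 by lra.
near=> n.
have l0 : 0 < ln n%:R :> R by near: n.
have [TX /andP[_ X2]] : 0 < tail Hs (expR (psi (k * ln n%:R))) /\
  k / 2 * ln n%:R <= - ln (tail Hs (expR (psi (k * ln n%:R)))) <= 2 * k * ln n%:R.
  by near: n; exact: tail_Hs_scaled.
have [TY /andP[Y1 _]] : 0 < tail Hs (expR (psi ((4 * k + 2) * ln n%:R))) /\
  (4 * k + 2) / 2 * ln n%:R <= - ln (tail Hs (expR (psi ((4 * k + 2) * ln n%:R)))) <=
    2 * (4 * k + 2) * ln n%:R.
  by near: n; exact: tail_Hs_scaled.
have x0X : x0 < expR (psi (k * ln n%:R)) by near: n; exact: psi_gt.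
set X := expR (psi (k * _)) in TX X2 x0X *.
set Y := expR _ in TY Y1 *.
have X0 : 0 < X by exact: expR_gt0.
(* Monotonicity of [psi] is not assumed; the order of the two points is read off from their
   tails. *)
have XY : X <= Y.
  rewrite leNgt; apply/negP => YX.
  have := tail_nonincreasing (ltW YX) TY.
  rewrite -ler_ln ?posrE//; lra.
have /andP[_ b] := tail_log_ratio_bounds Hh HT x0X XY TY.
have hX : 0 < h X by exact: (auxiliary_gt0 Hh).
rewrite ler_pdivlMr// in b.
have : ln n%:R * h X <= (ln (tail Hs X) - ln (tail Hs Y)) * h X.
  by rewrite ler_pM2r//; lra.
lra.
Unshelve. all: by end_near. Qed.

Variables (f w : nat -> R) (kf Kf kw Kw : R).
Hypothesis f_bounds : \forall n \near \oo,
  0 < f n /\ kf * ln n%:R <= ln (f n) <= Kf * ln n%:R.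
Hypothesis w_bounds : \forall n \near \oo,
  0 < w n /\ kw * ln n%:R <= ln (w n) <= Kw * ln n%:R.
Hypotheses (kf_gt0 : 0 < kf) (kf_Kf : kf <= Kf) (kw_gt0 : 0 < kw) (kw_Kw : kw <= Kw).

Let kf2 : 0 < kf / 2 /\ kf / 2 < kf. Proof. by split; move: kf_gt0; lra. Qed.
Let kw2 : 0 < kw / 2 /\ kw / 2 < kw. Proof. by split; move: kw_gt0; lra. Qed.

(** Two exponents fit strictly between [Kf] and [kw]: the numerator lies below [expR (psi (k1 * z))]
    and the denominator above [expR (psi (k2 * z)) / (4 * k2 * z)], with [z = ln n]. The gap
    hypothesis absorbs the factor [z]. *)
Lemma quantile_ratio_cvg0 :
  Kf < kw ->
  (forall k1 k2, 0 < k1 -> k1 < k2 ->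
     psi (k2 * z) - psi (k1 * z) - ln z @[z --> +oo] --> +oo) ->
  tail_quantile nu (f n) / h (tail_quantile nu (w n)) @[n --> \oo] --> (0 : R).
Proof.
move=> Kfkw gap; have Kf0 := lt_le_trans kf_gt0 kf_Kf.
pose k1 := (2 * Kf + kw) / 3; pose k2 := (Kf + 2 * kw) / 3.
have [k10 k12] : 0 < k1 /\ k1 < k2 by rewrite /k1 /k2; split; lra.
have k20 := lt_trans k10 k12.
have [Kf1 k2w] : Kf < k1 /\ k2 < kw by rewrite /k1 /k2; split; lra.
clearbody k1 k2.
apply/cvgr0Pnorm_lt => e e0; near=> n.
have l0 : 0 < ln n%:R :> R by near: n.
have [_ Vf] : 0 < tail nu (expR (psi (k1 * ln n%:R))) <= (f n)^-1 /\
    tail_quantile nu (f n) <= expR (psi (k1 * ln n%:R)).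
  near: n; apply: (tail_quantile_upper (k := Kf)) => //.
  by apply: filterS f_bounds => n [? /andP[]].
(* This gives positivity of the numerator. *)
have Vf0 : expR (psi (kf / 2 * ln n%:R)) <= tail_quantile nu (f n).
  by near: n; exact: (tail_quantile_lower kf2.1 kf2.2 f_bounds).
have Vw : expR (psi (k2 * ln n%:R)) <= tail_quantile nu (w n).
  by near: n; exact: (tail_quantile_lower k20 k2w w_bounds).
have x0X : x0 < expR (psi (k2 * ln n%:R)) by near: n; exact: psi_gt.
have hX : expR (psi (k2 * ln n%:R)) <= 4 * k2 * ln n%:R * h (expR (psi (k2 * ln n%:R))).
  by near: n; exact: auxiliary_lower.
have hmono := auxiliary_nondecreasing Hh x0X Vw.
have h0 := auxiliary_gt0 Hh (lt_le_trans x0X Vw).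
have G : - ln (e / (8 * k2)) <= psi (k2 * ln n%:R) - psi (k1 * ln n%:R) - ln (ln n%:R).
  near: n.
  have /cvgryPge /(_ (- ln (e / (8 * k2)))) H := gap _ _ k10 k12.
  by have := near_scaled_ln ltr01 H; apply: filterS => n; rewrite mul1r.
have : expR (psi (k1 * ln n%:R)) * expR (ln (ln n%:R)) <=
    expR (ln (e / (8 * k2))) * expR (psi (k2 * ln n%:R)).
  by rewrite -!expRD ler_expR; lra.
rewrite !lnK ?posrE ?divr_gt0 ?mulr_gt0//.
move: (psi (k1 * _)) (psi (k2 * _)) Vf x0X Vw hX hmono => A B Vf x0X Vw hX hmono G'.
have V0 : 0 < tail_quantile nu (f n) by rewrite (lt_le_trans _ Vf0)// expR_gt0.
rewrite ger0_norm ?divr_ge0 ?ltW// ltr_pdivrMr//.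
apply: (le_lt_trans Vf).
rewrite -(ltr_pM2r l0); apply: (le_lt_trans G').
have : e / (8 * k2) * expR B <= e / (8 * k2) * (4 * k2 * ln n%:R * h (tail_quantile nu (w n))).
  rewrite ler_pM2l ?divr_gt0 ?mulr_gt0//. apply: (le_trans hX).
  by rewrite ler_pM2l// !mulr_gt0.
move/le_lt_trans; apply.
have -> : e / (8 * k2) * (4 * k2 * ln n%:R * h (tail_quantile nu (w n))) =
   e * h (tail_quantile nu (w n)) * ln n%:R / 2 by field; rewrite gt_eqF.
have : 0 < e * h (tail_quantile nu (w n)) * ln n%:R by rewrite !mulr_gt0.
lra.
Unshelve. all: by end_near. Qed.

(** The gap tends to -oo for every pair of exponents, so crude ones do: [kf / 2] below the
    numerator, [Kw + kf] above [w], then [4 * k + 2] from [auxiliary_upper]. The ratio ends up at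
    least 1, against [small]. *)
Lemma quantile_ratio_not_cvg0 :
  (forall k1 k2, 0 < k1 -> k1 < k2 ->
     psi (k2 * z) - psi (k1 * z) - ln z @[z --> +oo] --> -oo) ->
  ~ (tail_quantile nu (f n) / h (tail_quantile nu (w n)) @[n --> \oo] --> (0 : R)).
Proof.
move=> gap /cvgr0Pnorm_lt /(_ 1 ltr01) small.
have Kw0 := lt_le_trans kw_gt0 kw_Kw; have kf0 := kf_gt0; have kw0 := kw_gt0.
pose k1 := kf / 2; pose k := Kw + kf; pose K := 4 * k + 2.
have k10 : 0 < k1 by rewrite /k1; lra.
have k0 : 0 < k by rewrite /k; lra.
have k1K : k1 < K by rewrite /K /k1 /k; lra.
have /cvgrNyPle /(_ 0) gap1 := gap _ _ k10 k1K.
have {}gap1 := near_scaled_ln ltr01 gap1.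
near \oo => n.
have l0 : 0 < ln n%:R :> R by near: n.
have Vf : expR (psi (k1 * ln n%:R)) <= tail_quantile nu (f n).
  by near: n; exact: (tail_quantile_lower kf2.1 kf2.2 f_bounds).
have Vw0 : expR (psi (kw / 2 * ln n%:R)) <= tail_quantile nu (w n).
  by near: n; exact: (tail_quantile_lower kw2.1 kw2.2 w_bounds).
have [_ Vw] : 0 < tail nu (expR (psi (k * ln n%:R))) <= (w n)^-1 /\
    tail_quantile nu (w n) <= expR (psi (k * ln n%:R)).
  near: n; apply: (tail_quantile_upper (k := Kw)); [lra|rewrite /k; lra|].
  by apply: filterS w_bounds => n [? /andP[]].
have x0X : x0 < expR (psi (kw / 2 * ln n%:R)) by near: n; apply: psi_gt; lra.
have {}x0X := lt_le_trans x0X Vw0.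
have hX : h (expR (psi (k * ln n%:R))) * ln n%:R <= expR (psi (K * ln n%:R)).
  by near: n; exact: auxiliary_upper.
have hmono := auxiliary_nondecreasing Hh x0X Vw.
have h0 := auxiliary_gt0 Hh x0X.
have G : psi (K * ln n%:R) - psi (k1 * ln n%:R) - ln (ln n%:R) <= 0.
  by rewrite -(mul1r (ln n%:R)); near: n.
have : `|tail_quantile nu (f n) / h (tail_quantile nu (w n))| < 1 by near: n.
have V0 : 0 < tail_quantile nu (f n) by rewrite (lt_le_trans _ Vf)// expR_gt0.
rewrite ger0_norm ?divr_ge0 ?ltW// ltr_pdivrMr// mul1r; apply/negP; rewrite -leNgt.
apply: le_trans Vf; apply: (le_trans hmono).
rewrite -(ler_pM2r l0); apply: (le_trans hX).
have : expR (psi (K * ln n%:R)) <= expR (psi (k1 * ln n%:R)) * expR (ln (ln n%:R)).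
  by rewrite -expRD ler_expR; lra.
by rewrite lnK.
Unshelve. all: by end_near. Qed.

End negligibility.

(** * Power and log-power profiles *)

Section powers.
Variable R : realType.
Implicit Types (r s d z : R).

Lemma expR_pinfty : @expR R x @[x --> +oo] --> +oo.
Proof.
apply/cvgryPge => A; near=> x; apply: le_trans (expR_ge1Dx x).
have : A <= x by near: x; apply: nbhs_pinfty_ge; exact: num_real.
lra.
Unshelve. all: by end_near. Qed.

Lemma ln_pinfty : @ln R x @[x --> +oo] --> +oo.
Proof.
apply/cvgryPge => A; near=> x.
have x_ge : expR A <= x by near: x; apply: nbhs_pinfty_ge; exact: num_real.
by rewrite -[A]expRK ler_ln// posrE (lt_le_trans (expR_gt0 A)).
Unshelve. all: by end_near. Qed.

Lemma near_pinfty_gt (A : R) : \forall x \near +oo, A < x.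
Proof. by apply: nbhs_pinfty_gt; exact: num_real. Qed.

Lemma near_comp_pinfty (f : R -> R) (P : R -> Prop) : f x @[x --> +oo] --> +oo ->
  (\forall x \near +oo, P x) -> \forall x \near +oo, P (f x).
Proof. by move=> foo; exact: foo. Qed.

Lemma powRE_expR z r : 0 < z -> z `^ r = expR (r * ln z).
Proof. by move=> z0; rewrite /powR gt_eqF. Qed.

Lemma powR_pinfty s : 0 < s -> z `^ s @[z --> +oo] --> +oo.
Proof.
move=> s0; apply/cvgryPge => A; near=> z.
have z0 : 0 < z by near: z; exact: near_pinfty_gt.
rewrite powRE_expR//.
have Al : A / s <= ln z by near: z; move/cvgryPge : ln_pinfty; apply.
rewrite ler_pdivrMr// in Al; have := expR_ge1Dx (s * ln z); lra.
Unshelve. all: by end_near. Qed.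

(** With [t = ln z], the power is exp(r t) >= 1 + (r t)^2 / 2, and the quadratic term beats
    [s * t]. *)
Lemma powR_sub_ln_pinfty d r s : 0 < d -> 0 < r ->
  d * z `^ r - s * ln z @[z --> +oo] --> +oo.
Proof.
move=> d0 r0; apply/cvgryPge => A; near=> z.
have z0 : 0 < z by near: z; exact: near_pinfty_gt.
rewrite powRE_expR//.
have l1 : 1 + `|A| <= ln z by near: z; move/cvgryPge : ln_pinfty; apply.
have l2 : (1 + `|s|) / (d * r ^+ 2 / 2) <= ln z.
  by near: z; move/cvgryPge : ln_pinfty; apply.
set t := ln z in l1 l2 *.
have c0 : 0 < d * r ^+ 2 / 2 by rewrite divr_gt0// mulr_gt0// exprn_gt0.
rewrite ler_pdivrMr// in l2.
have A0 := normr_ge0 A; have t0 : 0 <= t by lra.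
have := expR_ge1Dxn 1 (mulr_ge0 (ltW r0) t0).
rewrite (_ : (2`!)%:R = 2 :> R)// => ex.
have {}ex := ler_wpM2l (ltW d0) ex.
have sl := ler_norm s; have al := ler_norm A.
have p1 : (1 + `|s|) * t <= t * (d * r ^+ 2 / 2) * t by rewrite ler_wpM2r.
have p2 : s * t <= `|s| * t by rewrite ler_wpM2r.
have -> : A = A + 0 by rewrite addr0.
apply: (@le_trans _ _ (d * (1 + (r * t) ^+ 2 / 2) - s * t)); last by rewrite lerD2r.
rewrite exprMn; lra.
Unshelve. all: by end_near. Qed.

(* Both bounds come from [expR x >= 1 + x] with [x = +- r (ln v - ln u)]. *)
Lemma powR_sub_bounds (u v r : R) : 0 < u -> u < v -> 0 < r ->
  r * u `^ r * (v - u) / v <= v `^ r - u `^ r <= r * v `^ r * (v - u) / u.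
Proof.
move=> u0 uv r0; have v0 := lt_trans u0 uv.
have pu : 0 < u `^ r by rewrite powR_gt0.
have pv : 0 < v `^ r by rewrite powR_gt0.
have l1 : 1 - u / v <= ln v - ln u.
  have := le_ln1Dx (x := u / v - 1); rewrite subrKC ln_div ?posrE// => H.
  have uv0 : 0 < u / v by rewrite divr_gt0.
  by have := H ltac:(lra); lra.
have l2 : ln v - ln u <= v / u - 1.
  have := le_ln1Dx (x := v / u - 1); rewrite subrKC ln_div ?posrE// => H.
  by apply: H; have : 0 < v / u; [rewrite divr_gt0|lra].
have E1 : v `^ r = u `^ r * expR (r * (ln v - ln u)).
  by rewrite !powRE_expR// -expRD; congr expR; ring.
have E2 : u `^ r = v `^ r * expR (- (r * (ln v - ln u))).
  by rewrite !powRE_expR// -expRD; congr expR; ring.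
apply/andP; split.
  have -> : r * u `^ r * (v - u) / v = u `^ r * (r * (1 - u / v)).
    by field; rewrite gt_eqF.
  have -> : v `^ r - u `^ r = u `^ r * (expR (r * (ln v - ln u)) - 1).
    by rewrite mulrBr mulr1 -E1.
  rewrite ler_pM2l//.
  apply: (@le_trans _ _ (r * (ln v - ln u))); first by rewrite ler_pM2l.
  by rewrite lerBrDl expR_ge1Dx.
have -> : r * v `^ r * (v - u) / u = v `^ r * (r * (v / u - 1)).
  by field; rewrite gt_eqF.
have -> : v `^ r - u `^ r = v `^ r * (1 - expR (- (r * (ln v - ln u)))).
  by rewrite mulrBr mulr1 -E2.
rewrite ler_pM2l//.
apply: (@le_trans _ _ (r * (ln v - ln u))); last by rewrite ler_pM2l.
have := expR_ge1Dx (- (r * (ln v - ln u))); lra.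
Qed.

End powers.

Section inverse_profiles.
Variable R : realType.

(** The inverses of l -> lambda l^gamma and of l -> rho exp(mu l^alpha). *)
Definition power_profile (lambda gamma z : R) := (z / lambda) `^ gamma^-1.
Definition log_profile (mu rho alpha z : R) := ((ln z - ln rho) / mu) `^ alpha^-1.

Lemma power_profile_pinfty (lambda gamma : R) : 0 < lambda -> 0 < gamma ->
  power_profile lambda gamma z @[z --> +oo] --> +oo.
Proof.
move=> l0 g0; apply: (cvg_comp _ _ _ (powR_pinfty _)); last by rewrite invr_gt0.
by apply: gt0_cvgMly; [rewrite invr_gt0|exact: cvg_id].
Qed.

Lemma power_profileK (lambda gamma z : R) : 0 < lambda -> 0 < gamma -> 0 < z ->
  lambda * power_profile lambda gamma z `^ gamma = z.
Proof.
move=> l0 g0 z0; rewrite /power_profile -powRrM mulVf ?gt_eqF// powRr1.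
  by rewrite mulrC divfK// gt_eqF.
by rewrite ltW// divr_gt0.
Qed.

Lemma log_profile_pinfty (mu rho alpha : R) : 0 < mu -> 0 < alpha ->
  log_profile mu rho alpha z @[z --> +oo] --> +oo.
Proof.
move=> m0 a0; apply: (cvg_comp _ _ _ (powR_pinfty _)); last by rewrite invr_gt0.
apply/cvgryPge => A; near=> z; rewrite ler_pdivlMr// lerBrDr.
by near: z; move/cvgryPge : (@ln_pinfty R); apply.
Unshelve. all: by end_near. Qed.

Lemma log_profileK (mu rho alpha z : R) : 0 < mu -> 0 < rho -> 0 < alpha -> rho < z ->
  rho * expR (mu * log_profile mu rho alpha z `^ alpha) = z.
Proof.
move=> m0 r0 a0 rz; have z0 := lt_trans r0 rz.
rewrite /log_profile -powRrM mulVf ?gt_eqF// powRr1.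
  rewrite [mu * _]mulrC divfK ?gt_eqF// expRB !lnK ?posrE//.
  by rewrite mulrC divfK// gt_eqF.
by rewrite divr_ge0 ?ltW// subr_gt0 ltr_ln.
Qed.

Lemma power_profile_gap (lambda gamma k1 k2 : R) :
  0 < lambda -> 0 < gamma -> 0 < k1 -> k1 < k2 ->
  power_profile lambda gamma (k2 * z) - power_profile lambda gamma (k1 * z) - ln z
    @[z --> +oo] --> +oo.
Proof.
move=> l0 g0 k10 k12; pose r := gamma^-1.
have r0 : 0 < r by rewrite invr_gt0.
have k20 := lt_trans k10 k12.
pose d := (k2 / lambda) `^ r - (k1 / lambda) `^ r.
have d0 : 0 < d.
  rewrite subr_gt0 gt0_ltr_powR ?inE ?nnegrE ?divr_ge0 ?ltW//.
  by rewrite ltr_pM2r// invr_gt0.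
apply/cvgryPge => A; near=> z.
have z0 : 0 < z by near: z; exact: near_pinfty_gt.
have E k : 0 < k -> power_profile lambda gamma (k * z) = (k / lambda) `^ r * z `^ r.
  by move=> k0; rewrite /power_profile mulrAC powRM ?divr_ge0 ?ltW.
rewrite !E// -mulrBl -/d -[ln z]mul1r.
by near: z; move/cvgryPge : (powR_sub_ln_pinfty 1 d0 r0); apply.
Unshelve. all: by end_near. Qed.

Section log_gap.
Variables (mu rho alpha k1 k2 : R).
Hypotheses (mu0 : 0 < mu) (rho0 : 0 < rho) (alpha0 : 0 < alpha).
Hypotheses (k10 : 0 < k1) (k12 : k1 < k2).
Let r := alpha^-1.
Let u z := (ln z + ln k1 - ln rho) / mu.
Let d := (ln k2 - ln k1) / mu.

Let r0 : 0 < r. Proof. by rewrite invr_gt0. Qed.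
Let d0 : 0 < d.
Proof. by rewrite divr_gt0// subr_gt0 ltr_ln ?posrE// (lt_trans k10). Qed.

Let u_pinfty : u z @[z --> +oo] --> +oo.
Proof.
apply/cvgryPge => A; near=> z; rewrite ler_pdivlMr// -addrA -lerBlDr.
by near: z; move/cvgryPge : (@ln_pinfty R); apply.
Unshelve. all: by end_near. Qed.

(** Passing from [k1] to [k2] shifts the base of the power by the constant [d], and [ln z] is affine
    in that base [u]. So an increment of order u^(r - 1) competes with [mu * u], and the threshold
    is r = 2, that is alpha = 1/2. *)
Let gapE z : 0 < z ->
  log_profile mu rho alpha (k2 * z) - log_profile mu rho alpha (k1 * z) - ln z =
  (u z + d) `^ r - u z `^ r - (mu * u z - ln k1 + ln rho).
Proof.
move=> z0; rewrite /log_profile -/r !lnM ?posrE// ?(lt_trans k10)//.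
have -> : (ln k2 + ln z - ln rho) / mu = u z + d by rewrite /u /d -mulrDl; congr (_ / _); ring.
have -> : (ln k1 + ln z - ln rho) / mu = u z by rewrite /u; congr (_ / _); ring.
by congr (_ - _); rewrite mulrC divfK ?gt_eqF//; ring.
Qed.

Lemma log_profile_gap_pinfty : alpha < 1 / 2 ->
  log_profile mu rho alpha (k2 * z) - log_profile mu rho alpha (k1 * z) - ln z
    @[z --> +oo] --> +oo.
Proof.
move=> a2; have m0 := mu0; have dd0 := d0; have rr0 := r0; have rh0 := rho0.
have r2 : 0 < r - 2 by rewrite subr_gt0 -[ltLHS]invrK ltf_pV2 ?posrE//; lra.
apply/cvgryPge => A; near=> z.
have z0 : 0 < z by near: z; exact: near_pinfty_gt.
rewrite gapE//.
have ud : d <= u z by near: z; move/cvgryPge : u_pinfty; apply.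
have uA : 1 + `|A - ln k1 + ln rho| <= u z by near: z; move/cvgryPge : u_pinfty; apply.
(* By [powR_sub_bounds] and [d <= w], the increment is at least r d w^(r - 1) / 2. This threshold
   lifts it to [(mu + 1) * w], which leaves a full [w] against the constants. *)
have up : 2 * (mu + 1) / (r * d) <= u z `^ (r - 2).
  near: z; have /cvgryPge /(_ (2 * (mu + 1) / (r * d))) H := powR_pinfty r2.
  exact: u_pinfty H.
set w := u z in ud uA up *.
have nA := normr_ge0 (A - ln k1 + ln rho); have lA := ler_norm (A - ln k1 + ln rho).
have w0 : 0 < w by lra.
have wd : w < w + d by rewrite ltrDl.
have /andP[b _] := powR_sub_bounds w0 wd r0.
rewrite (addrC w) addrK addrC in b.
have pE : w `^ r = w `^ (r - 2) * w ^+ 2.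
  by rewrite -powR_mulrn ?ltW// -powRD ?subrK// gt_eqF// implybT.
have wd0 : 0 < w + d by rewrite addr_gt0.
have {}b : (mu + 1) * w <= (w + d) `^ r - w `^ r.
  apply: le_trans b; rewrite ler_pdivlMr// pE.
  rewrite (ler_pdivrMr _ _ (mulr_gt0 rr0 dd0)) in up.
  have p1 := ler_wpM2r (sqr_ge0 w) up.
  have p2 : (mu + 1) * w * d <= (mu + 1) * w * w.
    have m1w : 0 <= (mu + 1) * w by rewrite mulr_ge0 ?addr_ge0 ?ltW.
    by rewrite ler_wpM2l.
  lra.
lra.
Unshelve. all: by end_near. Qed.

Lemma log_profile_gap_ninfty : 1 / 2 < alpha -> alpha < 1 ->
  log_profile mu rho alpha (k2 * z) - log_profile mu rho alpha (k1 * z) - ln z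
    @[z --> +oo] --> -oo.
Proof.
move=> a2 a1; have m0 := mu0; have dd0 := d0; have rr0 := r0; have rh0 := rho0.
have r2 : 0 < 2 - r by rewrite subr_gt0 -[ltRHS]invrK ltf_pV2 ?posrE//; lra.
apply/cvgrNyPle => A; near=> z.
have z0 : 0 < z by near: z; exact: near_pinfty_gt.
rewrite gapE//.
have ud : d <= u z by near: z; move/cvgryPge : u_pinfty; apply.
have uA : 1 + 2 * `|A - mu * d - ln k1 + ln rho| / mu <= u z.
  by near: z; move/cvgryPge : u_pinfty; apply.
(* With [v <= 2 * w], this threshold bounds the increment by [mu * v / 2]; about half of [mu * w]
   then remains to absorb the constants. *)
have up : 4 * (r * d) / mu <= (u z + d) `^ (2 - r).
  near: z; have /cvgryPge /(_ (4 * (r * d) / mu)) H := powR_pinfty r2.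
  have ud_pinfty : u z + d @[z --> +oo] --> +oo.
    apply/cvgryPge => B; near=> z; rewrite -lerBlDr.
    by near: z; move/cvgryPge : u_pinfty; apply.
  exact: ud_pinfty H.
set w := u z in ud uA up *.
have nA := normr_ge0 (A - mu * d - ln k1 + ln rho).
have lA : - (A - mu * d - ln k1 + ln rho) <= `|A - mu * d - ln k1 + ln rho|.
  by rewrite -normrN ler_norm.
have w0 : 0 < w by lra.
have wd : w < w + d by rewrite ltrDl.
have /andP[_ b] := powR_sub_bounds w0 wd r0.
rewrite (addrC w) addrK addrC in b.
set v := w + d in up b *.
have v0 : 0 < v by rewrite addr_gt0.
have pE : v `^ r * v `^ (2 - r) = v ^+ 2.
  by rewrite -powR_mulrn ?ltW// -powRD ?subrKC// gt_eqF// implybT.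
have vp : 0 < v `^ r by rewrite powR_gt0.
have {}b : v `^ r - w `^ r <= mu * v / 2.
  apply: (le_trans b); rewrite ler_pdivrMr//.
  rewrite ler_pdivrMr// in up.
  have p1 := ler_wpM2l (ltW vp) up.
  have p2 : mu * v * v / 2 <= mu * v * w.
    have mv : 0 <= mu * v by rewrite mulr_ge0 ?ltW.
    have vw : v / 2 <= w by rewrite /v; lra.
    by rewrite -mulrA ler_wpM2l.
  rewrite [leRHS]mulrA pE in p1; lra.
have uA' : 2 * `|A - mu * d - ln k1 + ln rho| <= mu * w.
  by rewrite [leRHS]mulrC -ler_pdivrMr//; lra.
have md := mulr_gt0 m0 dd0.
rewrite /v in b *; lra.
Unshelve. all: by end_near. Qed.

End log_gap.
End inverse_profiles.

(** * From the asymptotics of the tail to its logarithmic profile *)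

Section tail_profiles.
Variable R : realType.

(** At [x = expR l] the logarithm of the tail is [ln c + e * l + xi * ln l + kappa l + o(1)], in
    which all but [kappa l] is o(phi l); substituting [l = psi z] turns [phi l] into [z]. Keeping
    [kappa] apart from [- phi] leaves room for further factors of lower order. *)
Lemma tail_profile_asymptotics (T kappa phi psi : R -> R) (c e xi : R) :
  0 < c ->
  l / phi l @[l --> +oo] --> (0 : R) ->
  kappa l / phi l @[l --> +oo] --> (- 1 : R) ->
  (\forall l \near +oo, 0 < phi l) ->
  psi z @[z --> +oo] --> +oo ->
  (\forall z \near +oo, phi (psi z) = z) ->
  asymp_equiv T (fun x => c * x `^ e * ln x `^ xi * expR (kappa (ln x))) ->
  - ln (T (expR (psi z))) / z @[z --> +oo] --> (1 : R).
Proof.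
move=> c0 lphi kphi phi0 psioo psiK Tg.
set g := (fun x => _) in Tg.
have near1 : \forall l \near +oo, 1 < l :> R by exact: near_pinfty_gt.
have dominated (f : R -> R) : (\forall l \near +oo, 0 <= f l <= l) ->
    f l / phi l @[l --> +oo] --> (0 : R).
  move=> fl; apply: (squeeze_cvgr (f := cst 0) (h := fun l => l / phi l)) => //.
    near=> l; have p0 : 0 < phi l by near: l.
    have /andP[f0 f1] : 0 <= f l <= l by near: l.
    by rewrite divr_ge0 ?(ltW p0)// ler_pM2r// invr_gt0.
  exact: cvg_cst.
have phi1 : (phi l)^-1 @[l --> +oo] --> (0 : R).
  rewrite (_ : (fun l => _) = (fun l => 1 / phi l)); last first.
    by apply/funext => l; rewrite div1r.
  apply: (dominated (cst 1)).
  by apply: filterS near1 => l l1; rewrite /= ler01 ltW.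
have lnphi : ln l / phi l @[l --> +oo] --> (0 : R).
  apply: dominated; apply: filterS near1 => l l1.
  by rewrite ln_ge0 ?ltW// ln_sublinear// (lt_trans ltr01).
have ratio : ln (T (expR l) / g (expR l)) @[l --> +oo] --> (0 : R).
  rewrite -(ln1 R); apply: continuous_cvg; first exact: continuous_ln.
  exact: (cvg_comp _ _ (@expR_pinfty R) Tg).
have ratio0 : \forall x \near +oo, 0 < T x / g x.
  by apply: (cvgr_gt (1 : R)) => //; exact: Tg.
have ratio1 := near_comp_pinfty (P := fun x => 0 < T x / g x) (@expR_pinfty R) ratio0.
have {ratio1}ratio2 := near_comp_pinfty (P := fun l => 0 < T (expR l) / g (expR l)) psioo ratio1.
have psi0 : \forall z \near +oo, 0 < psi z.
  by apply: (near_comp_pinfty (P := fun x => 0 < x) psioo); exact: near_pinfty_gt.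
pose N l := - ((ln (T (expR l) / g (expR l)) + ln c) * (phi l)^-1
   + e * (l / phi l) + xi * (ln l / phi l) + kappa l / phi l).
have N1 : N l @[l --> +oo] --> (1 : R).
  rewrite -[1](_ : - ((0 + ln c) * 0 + e * 0 + xi * 0 + - 1) = 1); last by ring.
  apply: cvgN; apply: cvgD => //; apply: cvgD; last first.
    by apply: cvgM => //; exact: cvg_cst.
  apply: cvgD; last by apply: cvgM => //; exact: cvg_cst.
  apply: cvgM => //; apply: cvgD => //; exact: cvg_cst.
apply: cvg_trans (cvg_comp _ _ psioo N1).
apply: near_eq_cvg; near=> z.
have pz : phi (psi z) = z by near: z.
have Tg0 : 0 < T (expR (psi z)) / g (expR (psi z)).
  by near: z.
have l0 : 0 < psi z by near: z.
have g0 : 0 < g (expR (psi z)).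
  by rewrite /g !mulr_gt0 ?powR_gt0 ?expR_gt0// expRK.
have T0 : 0 < T (expR (psi z)) by rewrite -(pmulr_lgt0 _ (_ : 0 < (g (expR (psi z)))^-1)) ?invr_gt0.
rewrite /= /N ln_div ?posrE// pz.
rewrite /g !lnM ?posrE ?mulr_gt0 ?powR_gt0 ?expR_gt0 ?expRK//.
rewrite !ln_powR !expRK; ring.
Unshelve. all: by end_near. Qed.

Lemma ratio_power_profile_cvg0 (lambda gamma : R) : 1 < gamma -> 0 < lambda ->
  l / (lambda * l `^ gamma) @[l --> +oo] --> (0 : R).
Proof.
move=> g1 l0; have g0 : 0 < gamma - 1 by rewrite subr_gt0.
apply/cvgr0Pnorm_lt => eps eps0; near=> l.
have l1 : 0 < l by near: l; exact: near_pinfty_gt.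
have lp : (lambda * eps)^-1 < l `^ (gamma - 1).
  by near: l; move/cvgryPgt : (powR_pinfty g0); apply.
have pE : l `^ gamma = l * l `^ (gamma - 1) by rewrite mulr_powRB1 ?ltW// (lt_trans _ g1).
have p0 : 0 < l `^ (gamma - 1) by rewrite powR_gt0.
rewrite pE mulrCA invfM mulrA divff ?gt_eqF// mul1r ger0_norm; last first.
  by rewrite invr_ge0 ltW// mulr_gt0.
rewrite -[ltRHS]invrK ltf_pV2 ?posrE ?invr_gt0 ?mulr_gt0//.
rewrite -ltr_pdivrMl// -invfM//.
Unshelve. all: by end_near. Qed.

(** In logarithms this is [powR_sub_ln_pinfty]. In (b) it is applied with [s = 1] for the factor x^e
    and with [s = gamma] for exp(lambda (log x)^gamma). *)
Lemma ratio_exp_profile_cvg0 (mu rho alpha s : R) : 0 < mu -> 0 < rho -> 0 < alpha ->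
  l `^ s / (rho * expR (mu * l `^ alpha)) @[l --> +oo] --> (0 : R).
Proof.
move=> m0 r0 a0; apply/cvgr0Pnorm_lt => eps eps0; near=> l.
have l1 : 0 < l by near: l; exact: near_pinfty_gt.
have gap : - ln (rho * eps) < mu * l `^ alpha - s * ln l.
  by near: l; move/cvgryPgt : (powR_sub_ln_pinfty s m0 a0); apply.
rewrite ger0_norm; last by rewrite divr_ge0 ?powR_ge0// mulr_ge0 ?expR_ge0 ?ltW.
rewrite ltr_pdivrMr ?mulr_gt0 ?expR_gt0// powRE_expR// mulrCA mulrA.
rewrite -[rho * eps]lnK ?posrE ?mulr_gt0// -expRD ltr_expR; lra.
Unshelve. all: by end_near. Qed.

End tail_profiles.

Lemma chain_growth_bounds (R : realType) (p : int -> int -> R) (q : int -> R)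
    (P : int -> probability path_space R) (beta : R) :
  (forall i, two_sided_law p q i (P i)) -> (forall i, 0 <= q i) -> q 0 = 1 ->
  0 < beta < 1 / 2 -> assumption_A1 P beta ->
  exists kf Kf kw Kw : R,
  [/\ \forall n \near \oo, 0 < 1 / return_tail P n /\
        kf * ln n%:R <= ln (1 / return_tail P n) <= Kf * ln n%:R,
      \forall n \near \oo, 0 < wandering_rate q P n /\
        kw * ln n%:R <= ln (wandering_rate q P n) <= Kw * ln n%:R,
      0 < kf <= Kf, 0 < kw <= Kw & Kf < kw].
Proof.
move=> HP qge0 q0 /andP[b0 b1] [[L sL FE] _].
have [F0 Fb] := regular_variation_ln_bounds (return_tail_nonincreasing P) FE sL.
(* The first bound keeps [kf = beta - eps] positive; the second gives [beta + eps < 1 - beta - eps],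
   that is [Kf < kw], which is where [beta < 1 / 2] enters. The exponent [Kw = 2] comes from
   [n + 1 <= n ^ 2]. *)
pose eps := Num.min (beta / 2) ((1 - 2 * beta) / 4).
have e0 : 0 < eps by rewrite lt_min; apply/andP; split; lra.
have e1 : eps <= beta / 2 by rewrite ge_min lexx.
have e2 : eps <= (1 - 2 * beta) / 4 by rewrite ge_min lexx orbT.
have {}Fb := Fb eps; have eb : 0 < eps <= beta by apply/andP; split; lra.
exists (beta - eps), (beta + eps), (1 - beta - eps), 2; split; [| | | |lra].
- near=> n.
  have Fn : 0 < return_tail P n by near: n.
  have : - (beta + eps) * ln n%:R <= ln (return_tail P n) <= - (beta - eps) * ln n%:R.
    by near: n; exact: Fb.
  rewrite div1r invr_gt0 Fn lnV ?posrE// => /andP[f1 f2].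
  by split => //; apply/andP; split; lra.
- near=> n.
  have Fn : 0 < return_tail P n by near: n.
  have : - (beta + eps) * ln n%:R <= ln (return_tail P n) <= - (beta - eps) * ln n%:R.
    by near: n; exact: Fb.
  move=> /andP[f1 _].
  have n2 : (2 <= n)%N by near: n; exact: nbhs_infty_ge.
  have n0 : 0 < n%:R :> R by rewrite ltr0n ltnW.
  have wge := wandering_rate_ge HP qge0 q0 n.
  have wle := wandering_rate_le HP qge0 q0 n.
  have w0 : 0 < wandering_rate q P n by rewrite (lt_le_trans _ wge)// mulr_gt0.
  split => //; apply/andP; split.
    apply: (@le_trans _ _ (ln (n%:R * return_tail P n))).
      by rewrite lnM ?posrE//; lra.
    rewrite ler_ln ?posrE ?mulr_gt0//; apply: le_trans wge.
    by rewrite ler_pM2r// ler_nat.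
  apply: (@le_trans _ _ (ln (n%:R ^+ 2))).
    rewrite ler_ln ?posrE ?exprn_gt0//; apply: (le_trans wle).
    rewrite -natrX ler_nat; apply: (@leq_trans (n * 2)).
      by rewrite muln2 -addnn -addn1 leq_add2l ltnW.
    by rewrite expnS expn1 leq_mul2l n2 orbT.
  by rewrite lnXn// mulr_natl.
- by apply/andP; split; lra.
- by apply/andP; split; lra.
Unshelve. all: by end_near. Qed.

(** * Assembly of the two cases *)

Theorem mainTheorem3 (R : realType)
    (p : int -> int -> R) (q : int -> R) (P : int -> probability path_space R)
    (beta : R) (nu : {measure set (measurableTypeR R) -> \bar R}) (h : R -> R) :
  transition_matrix p ->
  irreducible_chain p ->
  aperiodic_chain p ->
  unique_invariant_measure p q ->
  (forall i, two_sided_law p q i (P i)) ->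
  null_recurrent P ->
  0 < beta < 1 / 2 ->
  assumption_A1 P beta ->
  levy_measure nu ->
  assumption_A2 nu h ->
  (forall gamma lambda c e xi : R,
     1 < gamma -> 0 < lambda -> 0 < c ->
     asymp_equiv (tail nu)
       (fun x => c * x `^ e * ln x `^ xi * expR (- (lambda * ln x `^ gamma))) ->
     negligible_jumps q P nu h)
  /\
  (forall alpha c mu rho e xi lambda gamma : R,
     0 < alpha < 1 -> 0 < c -> 0 < mu -> 0 < rho ->
     asymp_equiv (tail nu)
       (fun x => c * x `^ e * ln x `^ xi * expR (lambda * ln x `^ gamma) *
                 expR (- (rho * expR (mu * ln x `^ alpha)))) ->
     (alpha < 1 / 2 -> negligible_jumps q P nu h) /\
     (1 / 2 < alpha -> ~ negligible_jumps q P nu h)).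
Proof.
move=> _ _ _ [[qge0 _] q0 _] HP _ beta_lt HA1 _ [_ _ [Hs [a [x0 [dh [a0 nuHs Hh HT _]]]]]].
have [kf [Kf [kw [Kw [fb wb /andP[kf0 kfK] /andP[kw0 kwK] Kfkw]]]]] :=
  chain_growth_bounds HP qge0 q0 beta_lt HA1.
split.
- move=> gamma lambda c e xi g1 l0 c0 nu_tail; have g0 := lt_trans ltr01 g1.
  have tail_psi : - ln (tail nu (expR (power_profile lambda gamma z))) / z
      @[z --> +oo] --> (1 : R).
    apply: (tail_profile_asymptotics (kappa := fun l => - (lambda * l `^ gamma))
      (phi := fun l => lambda * l `^ gamma) c0 _ _ _ _ _ nu_tail).
    + exact: ratio_power_profile_cvg0.
    + apply: cvg_near_cst; near=> l.
      have ll : 0 < l by near: l; exact: near_pinfty_gt.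
      by rewrite mulNr divff// gt_eqF// mulr_gt0// powR_gt0.
    + near=> l; have ll : 0 < l by near: l; exact: near_pinfty_gt.
      by rewrite mulr_gt0// powR_gt0.
    + exact: power_profile_pinfty.
    + by near=> z; apply: power_profileK => //; near: z; exact: near_pinfty_gt.
  apply: (quantile_ratio_cvg0 (f := fun n => 1 / return_tail P n)
    a0 nuHs Hh HT (power_profile_pinfty l0 g0) tail_psi fb wb) => // k1 k2.
  exact: power_profile_gap.
move=> alpha c mu rho e xi lambda gamma /andP[al0 al1] c0 m0 r0 nu_tail.
pose phi l := rho * expR (mu * l `^ alpha).
have tail_psi : - ln (tail nu (expR (log_profile mu rho alpha z))) / z
    @[z --> +oo] --> (1 : R).
  (* The factor exp(lambda (log x)^gamma) goes into [kappa], where it is negligible against [phi]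
     whatever the sign of [lambda] or [gamma]. *)
  apply: (tail_profile_asymptotics (kappa := fun l => lambda * l `^ gamma - phi l)
    (phi := phi) (e := e) (xi := xi) c0).
  + apply: cvg_trans (ratio_exp_profile_cvg0 1 m0 r0 al0); apply: near_eq_cvg; near=> l.
    by rewrite powRr1// ltW//; near: l; exact: near_pinfty_gt.
  + have lim : lambda * (l `^ gamma / phi l) - 1 @[l --> +oo] --> lambda * 0 - 1.
      apply: cvgB; last exact: cvg_cst.
      by apply: cvgM; [exact: cvg_cst|exact: ratio_exp_profile_cvg0].
    rewrite mulr0 sub0r in lim; apply: cvg_trans lim; apply: near_eq_cvg; near=> l.
    by rewrite /= mulrBl mulrA divff// gt_eqF// mulr_gt0// expR_gt0.
  + by near=> l; rewrite mulr_gt0// expR_gt0.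
  + exact: log_profile_pinfty.
  + by near=> z; apply: log_profileK => //; near: z; exact: near_pinfty_gt.
  + move: nu_tail; congr (asymp_equiv (tail nu) _); apply/funext => x.
    by rewrite -!mulrA -expRD.
split => alt.
- apply: (quantile_ratio_cvg0 (f := fun n => 1 / return_tail P n)
    a0 nuHs Hh HT (log_profile_pinfty rho m0 al0) tail_psi fb wb) => // k1 k2 k10 k12.
  exact: log_profile_gap_pinfty.
- apply: (quantile_ratio_not_cvg0 (f := fun n => 1 / return_tail P n)
    a0 nuHs Hh HT (log_profile_pinfty rho m0 al0) tail_psi fb wb) => // k1 k2 k10 k12.
  exact: log_profile_gap_ninfty.
Unshelve. all: by end_near. Qed.
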